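(* Let $0\le p\le 1$ and $1<\alpha<2$, and let $\mu,\nu$ be real numbers with $\alpha-2\le\mu,\nu\le 0$ satisfying $$\mu+\nu=\alpha-2,\qquad p\sin(\pi\mu)=(1-p)\sin(\pi\nu).$$ Then for $x\in(-1,1)$ and every $n=0,1,2,\ldots$, $$\mathcal{I}_{p,-1,1}^{\mu,\nu,2-\alpha}J_{n}^{-\mu,-\nu}(x)=\lambda_{n}P_{n}^{\nu,\mu}(x),\qquad \lambda_{n}=\frac{\Gamma(n+\alpha-1)}{\Gamma(n+1)},$$ and for every integer $k\ge 1$, $$\mathcal{D}_{p,-1,1}^{\mu,\nu,k+\alpha-2}J_{n}^{-\mu,-\nu}(x)=\tilde{C}_{\alpha}P_{n-k}^{\nu+k,\mu+k}(x),\qquad \tilde{C}_{\alpha}=\frac{\Gamma(n+k+\alpha-1)}{2^k\Gamma(n+1)}.$$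
   Context: $P_n^{a,b}$ is the classical Jacobi polynomial of degree $n$ (with the convention $P_m^{a,b}\equiv 0$ for $m<0$). The Jacobi poly-fractonomials are $J_n^{-\mu,-\nu}(x):=(1-x)^{\mu}(1+x)^{\nu}P_n^{\mu,\nu}(x)$, $x\in(-1,1)$. For $\sigma>0$, ${}_{-1}I_x^{\sigma}v(x)=\frac{1}{\Gamma(\sigma)}\int_{-1}^x (x-y)^{\sigma-1}v(y)\,dy$ and ${}_{x}I_1^{\sigma}v(x)=\frac{1}{\Gamma(\sigma)}\int_x^1 (y-x)^{\sigma-1}v(y)\,dy$. With $C_{\alpha,p}:=(\sin\pi\mu+\sin\pi\nu)/\sin\pi\alpha$, the two-sided fractional integral is $\mathcal{I}_{p,-1,1}^{\mu,\nu,\varrho}v:=C_{\alpha,p}\big(p\,{}_{-1}I_x^{\varrho}v+(1-p)\,{}_{x}I_1^{\varrho}v\big)$, and for $q\in(k-1,k)$, $k\in\mathbb{N}$, the two-sided Riemann–Liouville derivative is $\mathcal{D}_{p,-1,1}^{\mu,\nu,q}v:=\frac{d^k}{dx^k}\mathcal{I}_{p,-1,1}^{\mu,\nu,k-q}v$. *)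

(* Defs.v *)
From HB Require Import structures.
From mathcomp Require Import all_boot all_order all_algebra.
From mathcomp Require Import all_classical all_reals all_analysis.
Set Implicit Arguments. Unset Strict Implicit. Unset Printing Implicit Defensive.
Import Order.TTheory GRing.Theory Num.Theory.
Import numFieldNormedType.Exports.
Local Open Scope classical_set_scope.
Local Open Scope ring_scope.

Section Defs.
Variable R : realType.

Definition Gamma (s : R) : R :=
  Rintegral lebesgue_measure `]0, +oo[ (fun t => t `^ (s - 1) * expR (- t)).

Definition gbinom (z : R) (j : nat) : R :=
  (\prod_(i < j) (z - i%:R)) / (j`!)%:R.

(* classical Jacobi polynomial P_n^{a,b}(x) for arbitrary real a, b (DLMF 18.5.8) *)
Definition jacobiP (a b : R) (n : nat) (x : R) : R :=
  \sum_(m < n.+1) gbinom (n%:R + a) (n - m) * gbinom (n%:R + b) m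
     * ((x - 1) / 2) ^+ m * ((x + 1) / 2) ^+ (n - m).

(* Jacobi poly-fractonomial J_n^{-mu,-nu}(x) = (1-x)^mu (1+x)^nu P_n^{mu,nu}(x) *)
Definition polyfrac (mu nu : R) (n : nat) (x : R) : R :=
  (1 - x) `^ mu * (1 + x) `^ nu * jacobiP mu nu n x.

Definition leftRLint (sigma : R) (v : R -> R) (x : R) : R :=
  (Gamma sigma)^-1 *
  Rintegral lebesgue_measure `]-1, x[ (fun y => (x - y) `^ (sigma - 1) * v y).

Definition rightRLint (sigma : R) (v : R -> R) (x : R) : R :=
  (Gamma sigma)^-1 *
  Rintegral lebesgue_measure `]x, 1[ (fun y => (y - x) `^ (sigma - 1) * v y).

Definition Calpha (alpha mu nu : R) : R :=
  (sin (pi * mu) + sin (pi * nu)) / sin (pi * alpha).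

Definition twoSidedInt (alpha p mu nu rho : R) (v : R -> R) (x : R) : R :=
  Calpha alpha mu nu * (p * leftRLint rho v x + (1 - p) * rightRLint rho v x).

Definition is_kth_derivative_on (a b : R) (k : nat) (f g : R -> R) : Prop :=
  exists h : nat -> R -> R,
    (forall x, a < x < b -> h 0%N x = f x) /\
    (forall j : nat, (j < k)%N -> forall x, a < x < b ->
        is_derive x 1 (h j) (h j.+1 x)) /\
    (forall x, a < x < b -> h k x = g x).

End Defs.

(* Main.v *)
(* Put s = 2 - alpha, so that mu + nu = - s. Truncated powers turn fractional
   integrals into convolutions on the line, for which Tonelli's theorem gives
   the semigroup law. The weight (1 - y)^mu (1 + y)^nu is a left and a right
   fractional integral of order 1 - s of one and the same function; hence its
   one-sided integrals of order s are primitives of that function, and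
   p sin(pi mu) = (1 - p) sin(pi nu) together with Euler's reflection formula
   makes the two-sided combination constant. Multiplying the weight by powers of
   1 + y yields a recursion whose solution shows that the two-sided integral
   maps polynomials to polynomials and intertwines the Jacobi operators with
   parameters (mu, nu) and (nu, mu); comparing leading coefficients identifies
   the image of the Jacobi polynomial. Derivatives follow from
   d/dx P_n^{a,b} = (n + a + b + 1)/2 P_{n-1}^{a+1,b+1}. *)
Require Import Defs.
From HB Require Import structures.
From mathcomp Require Import all_boot all_order all_algebra.
From mathcomp Require Import all_classical all_reals all_analysis.
From mathcomp Require Import measurable_realfun.
From mathcomp Require Import ring lra.
Import Order.TTheory GRing.Theory Num.Theory.
Import numFieldNormedType.Exports.
Local Open Scope classical_set_scope.
Local Open Scope ring_scope.

(** Nearly all integrals are of nonnegative functions with values in the extended reals: Tonelli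
    then asks for no integrability, but subtraction is unsafe. Hence the moments of the weight
    against powers of [1 + y], all nonnegative, come before the Jacobi polynomial, whose
    coefficients may have either sign, and the two equations behind the recursion carry sums on both
    sides. The first, from [1 + y = (1 + x) - (x - y)], raises the power at the price of kernels of
    order [s + 1]. These are primitives of the kernel of order [s], so the second equation, the
    previous moment integrated from -1 to [x], eliminates them; the constant of integration is a
    Beta value at the left end. The balance condition acts in the form [(1 - p) Gamma(-mu) Gamma(1 +
    mu) = p Gamma(-nu) Gamma(1 + nu)]. At [mu = 0] or [nu = 0] it is replaced by [p = 1] or [p = 0],
    and the one surviving side is computed directly. For the reflection formula, Gamma(s) Gamma(1 -
    s) is cut along the diagonal into two integrals over the unit interval, which expand into
    alternating sums of reciprocals. *)

Section affine_change_of_variable.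

(** * Affine substitutions in Lebesgue integrals *)

Local Open Scope ereal_scope.
Context {R : realType}.
Local Notation leb := (@lebesgue_measure R).
Implicit Types (f : R -> \bar R) (a c : R).

(** [c] times the pushforward of Lebesgue measure under [t -> c t + a] has the right value on
    half-open intervals, and these determine Lebesgue measure. *)
Lemma lebesgue_measure_affine c a (A : set R) : (0 < c)%R -> measurable A ->
  leb ((fun t : R => c * t + a)%R @^-1` A) = c^-1%:E * leb A.
Proof.
move=> c0 mA.
pose phi : measurableTypeR R -> measurableTypeR R := fun t => (c * t + a)%R.
have mphi : measurable_fun setT phi.
  by apply: measurable_funD => //; exact: measurable_funM.
have c0' : (0 <= c)%R by exact: ltW.
pose m : {measure set (measurableTypeR R) -> \bar R} :=
  mscale (NngNum c0') (pushforward leb phi).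
suff -> : leb A = m mphi A.
  by rewrite /m/= /mscale/= muleA -EFinM mulVf ?gt_eqF// mul1e.
refine (@lebesgue_measure_unique R (m mphi) _ A mA) => // _ [[x y]] _ <- /=.
rewrite /m /mscale /= /pushforward.
rewrite (_ : phi @^-1` _ = `]((x - a) / c)%R, ((y - a) / c)%R]%classic); last first.
  apply/seteqP; split => t /=; rewrite !in_itv /= /phi.
    by rewrite ltr_pdivrMr// ler_pdivlMr// ltrBlDr lerBrDr mulrC.
  by rewrite ltr_pdivrMr// ler_pdivlMr// ltrBlDr lerBrDr mulrC.
rewrite !lebesgue_measure_itv/= !lte_fin ltr_pM2r ?invr_gt0// ltrD2r.
case: ifPn => _; last by rewrite mule0.
rewrite -!EFinB -EFinM; congr EFin.
by rewrite -mulrBl mulrCA divff ?gt_eqF// mulr1; ring.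
Qed.

Lemma ge0_integral_affine (f : R -> R) c a : (0 < c)%R ->
  measurable_fun setT f -> (forall x, 0 <= f x)%R ->
  \int[leb]_x (f (c * x + a)%R)%:E = c^-1%:E * \int[leb]_x (f x)%:E.
Proof.
move=> c0 mf f0.
pose phi : measurableTypeR R -> measurableTypeR R := fun t => (c * t + a)%R.
have mphi : measurable_fun setT phi.
  by apply: measurable_funD => //; exact: measurable_funM.
have mF : measurable_fun setT (EFin \o f) by exact/measurable_EFinP.
have F0 x : 0 <= (EFin \o f) x by rewrite lee_fin.
have := @ge0_integral_pushforward _ _ _ _ R phi mphi leb setT _ measurableT mF.
rewrite preimage_setT => /(_ (fun y _ => F0 y)) <-.
have c0' : (0 <= c^-1)%R by rewrite invr_ge0 ltW.
rewrite -(@ge0_integral_mscale _ _ R leb setT measurableT (NngNum c0') (EFin \o f))//.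
apply: eq_measure_integral => A mA _.
exact: lebesgue_measure_affine.
Qed.

Lemma ge0_integral_scale (f : R -> R) c : (0 < c)%R ->
  measurable_fun setT f -> (forall x, 0 <= f x)%R ->
  \int[leb]_x (f (c * x)%R)%:E = c^-1%:E * \int[leb]_x (f x)%:E.
Proof.
move=> c0 mf f0; rewrite -(ge0_integral_affine f c 0)//.
by apply: eq_integral => x _; rewrite addr0.
Qed.

Lemma ge0_integral_shift (f : R -> R) a :
  measurable_fun setT f -> (forall x, 0 <= f x)%R ->
  \int[leb]_x (f (x + a)%R)%:E = \int[leb]_x (f x)%:E.
Proof.
move=> mf f0; have := ge0_integral_affine f 1 a ltr01 mf f0.
by rewrite invr1 mul1e => <-; apply: eq_integral => x _; rewrite mul1r.
Qed.

Lemma ge0_integral_reflect (f : R -> R) a :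
  measurable_fun setT f -> (forall x, 0 <= f x)%R ->
  \int[leb]_x (f (a - x)%R)%:E = \int[leb]_x (f x)%:E.
Proof.
move=> mf f0; rewrite -[RHS](ge0_integral_shift f a)//.
have mN : measurable_fun setT ((fun x => (- x)%R) : measurableTypeR R -> measurableTypeR R).
  exact: (@measurable_funN _ _ _ setT id).
have mF : measurable_fun setT (fun x : R => (f (x + a)%R)%:E).
  by apply/measurable_EFinP/measurableT_comp => //; exact: measurable_funD.
have F0 x : 0 <= (f (x + a)%R)%:E by rewrite lee_fin.
have := @ge0_integral_pushforward _ _ _ _ R _ mN leb setT _ measurableT mF.
rewrite preimage_setT => /(_ (fun y _ => F0 y)) E.
etransitivity; first (etransitivity; last exact: (esym E)).
  by apply: eq_integral => x _ /=; rewrite addrC.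
by apply: eq_measure_integral => A mA _; exact: lebesgue_measureN.
Qed.

End affine_change_of_variable.

(** * Truncated powers as kernels on the whole line *)

Section truncated_power.
Local Open Scope ring_scope.
Context {R : realType}.
Local Notation leb := (@lebesgue_measure R).

Lemma tonelli_lebesgue (f : R -> R -> R) :
  measurable_fun setT (fun z : R * R => f z.1 z.2) ->
  (forall x y, 0 <= f x y) ->
  (\int[leb]_x \int[leb]_y (f x y)%:E = \int[leb]_y \int[leb]_x (f x y)%:E)%E.
Proof.
move=> mf f0.
apply: (@fubini_tonelli _ _ _ _ R leb leb (fun z => (f z.1 z.2)%:E)).
- exact/measurable_EFinP.
- by move=> z; rewrite lee_fin.
Qed.

(* [K a] is the kernel of the fractional integral of order [a] (not
   normalised): the exponent is [a - 1]. *)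
Definition K (a u : R) : R := if 0 < u then u `^ (a - 1) else 0.

Lemma K_ge0 a u : 0 <= K a u.
Proof. by rewrite /K; case: ifP => // _; exact: powR_ge0. Qed.

Lemma K_gt0E a u : 0 < u -> K a u = u `^ (a - 1).
Proof. by rewrite /K => ->. Qed.

Lemma K_le0 a u : u <= 0 -> K a u = 0.
Proof. by rewrite /K leNgt => /negbTE ->. Qed.

(** [K 1] serves as the indicator of the positive half-line; factors [K 1 (x - z)] replace bounds of
    integration throughout. *)
Lemma K1 u : K 1 u = if 0 < u then 1 else 0.
Proof. by rewrite /K subrr powRr0; case: ifP. Qed.

Lemma K_scale a c u : 0 < c -> K a (c * u) = c `^ (a - 1) * K a u.
Proof.
move=> c0; rewrite /K pmulr_rgt0//; case: ifPn => u0; last by rewrite mulr0.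
by rewrite powRM// ltW.
Qed.

Lemma KM a b u : K a u * K b u = K (a + b - 1) u.
Proof.
rewrite /K; case: ifPn => u0; last by rewrite mulr0.
rewrite -powRD; last by apply/implyP => _; rewrite gt_eqF.
by congr (_ `^ _); ring.
Qed.

Lemma KS a u : u * K a u = K (a + 1) u.
Proof.
rewrite /K; case: ifPn => u0; last by rewrite mulr0.
rewrite -{1}[u]powRr1 ?ltW// -powRD; last by apply/implyP => _; rewrite gt_eqF.
by congr (_ `^ _); ring.
Qed.

Lemma K_nat n u : 0 < u -> K n.+1%:R u = u ^+ n.
Proof. by move=> u0; rewrite K_gt0E// -natr1 addrK powR_mulrn// ltW. Qed.

Lemma measurable_K a : measurable_fun setT (K a).
Proof.
apply: measurable_fun_ifT => //; exact: measurable_fun_ltr.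
Qed.

Lemma measurable_K_comp d (T : measurableType d) a (g : T -> R) :
  measurable_fun setT g -> measurable_fun setT (fun x => K a (g x)).
Proof. by move=> mg; exact: (measurableT_comp (measurable_K a)). Qed.

Lemma measurable_powR_comp d (T : measurableType d) a (g : T -> R) :
  measurable_fun setT g -> measurable_fun setT (fun x => g x `^ a).
Proof. by move=> mg; exact: (measurableT_comp (measurable_powR a)). Qed.

Lemma measurable_expR_comp d (T : measurableType d) (g : T -> R) :
  measurable_fun setT g -> measurable_fun setT (fun x => expR (g x)).
Proof. by move=> mg; exact: (measurableT_comp (@measurable_expR R)). Qed.

End truncated_power.

Ltac measR := repeat first
  [ exact: measurable_cst | exact: measurable_id
  | exact: measurable_fst | exact: measurable_snd
  | apply: measurable_K_comp | apply: measurable_funX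
  | apply: measurable_funM | apply: measurable_funD | apply: measurable_funN
  | apply: measurable_powR_comp | apply: measurable_expR_comp ].

Ltac nneg := repeat first
  [ exact: K_ge0 | exact: powR_ge0 | exact: expR_ge0
  | apply: mulr_ge0 | assumption ].

(** * The Gamma integral and a weighted product formula *)

Section gamma_integral.
Local Open Scope ring_scope.
Context {R : realType}.
Local Notation leb := (@lebesgue_measure R).
Implicit Types a b c : R.

Lemma ge0_integralZl_real (k : R) (f : R -> R) : 0 <= k ->
  measurable_fun setT f -> (forall x, 0 <= f x) ->
  (\int[leb]_x (k * f x)%:E = k%:E * \int[leb]_x (f x)%:E)%E.
Proof.
move=> k0 mf f0; under eq_integral do rewrite EFinM.
rewrite ge0_integralZl_EFin//; last exact/measurable_EFinP.
by move=> x _; rewrite lee_fin.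
Qed.

(** Extended-real values let identities be proved by Tonelli before finiteness is known; finiteness
    is then deduced from them. *)
Definition egamma (a : R) : \bar R := (\int[leb]_u (K a u * expR (- u))%:E)%E.

Lemma egamma_ge0 a : (0 <= egamma a)%E.
Proof. by apply: integral_ge0 => u _; rewrite lee_fin; nneg. Qed.

Lemma egamma_scale a c : 0 < c ->
  (\int[leb]_u (K a u * expR (- (c * u)))%:E = (c `^ (- a))%:E * egamma a)%E.
Proof.
move=> c0.
have mf : measurable_fun setT (fun u : R => K a u * expR (- u)) by measR.
transitivity (\int[leb]_u (c `^ (1 - a) * (K a (c * u) * expR (- (c * u))))%:E)%E.
  apply: eq_integral => u _; rewrite K_scale//; congr EFin.
  rewrite !mulrA -powRD; last by apply/implyP => _; rewrite gt_eqF.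
  by rewrite addrA subrK subrr powRr0 mul1r.
rewrite ge0_integralZl_real; first last.
- by move=> u; nneg.
- by measR.
- exact: powR_ge0.
rewrite (ge0_integral_scale (fun u => K a u * expR (- u)))//; last first.
  by move=> u; nneg.
rewrite muleA -EFinM; congr (_%:E * _)%E.
rewrite -[c^-1]powR_inv1 ?ltW// -powRD; last by apply/implyP => _; rewrite gt_eqF.
by congr (_ `^ _); ring.
Qed.


Lemma ge0_integralM_real (f g : R -> R) :
  measurable_fun setT f -> (forall x, 0 <= f x) ->
  measurable_fun setT g -> (forall x, 0 <= g x) ->
  ((\int[leb]_x (f x)%:E) * (\int[leb]_y (g y)%:E) =
   \int[leb]_x \int[leb]_y (f x * g y)%:E)%E.
Proof.
move=> mf f0 mg g0.
under [RHS]eq_integral do rewrite ge0_integralZl_real//.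
rewrite ge0_integralZr//; last first.
- by apply: integral_ge0 => y _; rewrite lee_fin.
- by move=> x _; rewrite lee_fin.
- exact/measurable_EFinP.
Qed.

(* Integrate [u^(a-1) v^(b-1) exp (- A u - B v)] over the quadrant along the
   lines [u + v = r], [u = r t]. *)
Lemma egamma_feynman a b (A B : R) : 0 < A -> 0 < B ->
  ((A `^ (- a))%:E * egamma a * ((B `^ (- b))%:E * egamma b) =
   egamma (a + b)%R * \int[leb]_t (K a t * K b (1 - t) *
     (A * t + B * (1 - t)) `^ (- (a + b)))%:E)%E.
Proof.
move=> A0 B0; rewrite -!egamma_scale// ge0_integralM_real; first last.
- by move=> x; nneg.
- by measR.
- by move=> x; nneg.
- by measR.
transitivity (\int[leb]_u \int[leb]_r
    (K a u * expR (- (A * u)) * (K b (r - u) * expR (- (B * (r - u)))))%:E)%E.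
  apply: eq_integral => u _.
  rewrite (ge0_integral_shift
    (fun v => K a u * expR (- (A * u)) * (K b v * expR (- (B * v)))))//.
  - by measR.
  - by move=> x; nneg.
rewrite tonelli_lebesgue; first last.
- by move=> x y; nneg.
- by measR.
transitivity (\int[leb]_r \int[leb]_t
    (K a t * K b (1 - t) * (K (a + b) r * expR (- ((A * t + B * (1 - t)) * r))))%:E)%E.
  (* For [r <= 0] the factors [K a u] and [K b (r - u)] are never both nonzero. *)
  apply: eq_integral => r _; have [r0|r0] := ltP 0 r; last first.
    rewrite !integral0_eq// => u _; first by rewrite (K_le0 (a + b))// mul0r mulr0.
    have [u0|u0] := ltP 0 u; last by rewrite (K_le0 a)// !mul0r.
    by rewrite (K_le0 b) ?mul0r ?mulr0// subr_le0 ltW// (le_lt_trans r0).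
  (* Substitution [u = r t]; the Jacobian appears as [r^-1] on the other side, so the equation is
     multiplied by [r]. *)
  have := ge0_integral_scale (fun u => K a u * expR (- (A * u)) *
     (K b (r - u) * expR (- (B * (r - u))))) r r0.
  move=> /(_ _ _)/(f_equal (fun z => r%:E * z)%E) H.
  transitivity (r%:E * (r^-1%:E * \int[leb]_u (K a u * expR (- (A * u)) *
     (K b (r - u) * expR (- (B * (r - u)))))%:E))%E.
    by rewrite muleA -EFinM divff ?gt_eqF// mul1e.
  rewrite -{}H; first last.
  - by move=> x; nneg.
  - by measR.
  rewrite -ge0_integralZl_real; first last.
  - by move=> x; nneg.
  - by measR.
  - exact: ltW.
  apply: eq_integral => t _; congr EFin.
  have -> : r - r * t = r * (1 - t) by ring.
  rewrite !K_scale//.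
  rewrite (_ : - ((A * t + B * (1 - t)) * r) = - (A * (r * t)) + - (B * (r * (1 - t)))); last by ring.
  rewrite expRD [K (a + b) r]K_gt0E//.
  have -> : r `^ (a + b - 1) = r * (r `^ (a - 1) * r `^ (b - 1)).
    rewrite -powRD; last by apply/implyP => _; rewrite gt_eqF.
    rewrite -{2}[r]powRr1 ?ltW// -powRD; last by apply/implyP => _; rewrite gt_eqF.
    by congr (_ `^ _); ring.
  ring.
rewrite tonelli_lebesgue; first last.
- by move=> x y; nneg.
- by measR.
rewrite [RHS]muleC -ge0_integralZr//; first last.
- exact: egamma_ge0.
- by move=> x _; rewrite lee_fin; nneg.
- by apply/measurable_EFinP; measR.
apply: eq_integral => t _.
rewrite ge0_integralZl_real; first last.
- by move=> x; nneg.
- by measR.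
- by nneg.
(* Only [0 < t < 1] contributes; there the rate [A t + B (1 - t)] is positive and the integral in
   [r] is a rescaled [egamma (a + b)]. *)
have [t0|t0] := ltP 0 t; last by rewrite (K_le0 _ _ t0) !mul0r !mul0e.
have [t1|t1] := ltP 0 (1 - t); last by rewrite (K_le0 _ _ t1) mulr0 mul0r !mul0e.
by rewrite egamma_scale ?muleA ?EFinM// addr_gt0// mulr_gt0.
Qed.

End gamma_integral.

(** * Functional equation, finiteness and positivity of Gamma; the Beta function *)

Section gamma_facts.
Local Open Scope ring_scope.
Context {R : realType}.
Local Notation leb := (@lebesgue_measure R).
Implicit Types a b c : R.

Lemma egamma1 : egamma (1 : R) = 1%E.
Proof.
rewrite -(@integral_exponential_pdf R 1 ltr01) /egamma.
transitivity (\int[leb]_(x in `]0%R, +oo[) (exponential_pdf 1 x)%:E)%E.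
  rewrite [RHS]integral_mkcond; apply: eq_integral => u _.
  rewrite patchE K1; case: ifPn => u0.
    rewrite mem_set/= ?in_itv/= ?u0// exponential_pdfE ?ltW//.
    by rewrite mulN1r.
  by rewrite memNset/= ?in_itv/= ?andbT ?mul0r//; exact/negP.
rewrite integral_itv_obnd_cbnd; last first.
  by apply/measurable_EFinP/measurable_funTS; exact: measurable_exponential_pdf.
rewrite integral_mkcond; apply: eq_integral => u _; rewrite patchE.
case: ifPn => //; rewrite notin_setE/= in_itv/= andbT => /negP; rewrite -ltNge => u0.
by rewrite lt0_exponential_pdf.
Qed.

Lemma integral_powR_itv (a e : R) : 0 < a -> 0 < e < 1 ->
  (\int[leb]_(t in `[e, 1%R]) (t `^ (a - 1))%:E = ((1 - e `^ a) / a)%:E)%E.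
Proof.
move=> a0 /andP[e0 e1].
rewrite (@continuous_FTC2 R _ (fun t => a^-1 * t `^ a))//.
- by rewrite -EFinB powR1 -mulrBr mulrC.
- apply: continuous_in_subspaceT => t; rewrite inE/= in_itv/= => /andP[et _].
  apply/differentiable_continuous/derivable1_diffP.
  by apply: derivable_powR; rewrite in_itv/= andbT (lt_le_trans e0).
- have dF (t : R) : 0 < t -> derivable (fun t => a^-1 * t `^ a) t 1.
    move=> t0; apply: derivableM => //.
    by apply: derivable_powR; rewrite in_itv/= andbT.
  have cF (t : R) : 0 < t -> {for t, continuous (fun t => a^-1 * t `^ a)}.
    by move=> t0; apply/differentiable_continuous/derivable1_diffP/dF.
  split.
  + by move=> t; rewrite in_itv/= => /andP[et _]; apply/dF/(lt_trans e0).
  + by apply: cvg_at_right_filter; exact: cF.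
  + by apply: cvg_at_left_filter; exact: cF.
- move=> t; rewrite in_itv/= => /andP[et _].
  have t0 : 0 < t by exact: lt_trans et.
  rewrite derive1E deriveM//; last first.
    by apply: derivable_powR; rewrite in_itv/= andbT.
  rewrite derive_cst scaler0 addr0 -derive1E powR_derive1 ?in_itv/= ?andbT//.
  by rewrite /GRing.scale/= mulrA mulVf ?gt_eqF// mul1r.
Qed.

Lemma integral_K_K1 (a : R) : 0 < a ->
  (\int[leb]_t (K a t * K 1 (1 - t))%:E = a^-1%:E)%E.
Proof.
move=> a0.
transitivity (\int[leb]_(t in `]0%R, 1%R]) (t `^ (a - 1))%:E)%E.
  rewrite -integral_itv_bndo_bndc; last first.
    by apply/measurable_EFinP/measurable_funTS; exact: measurable_powR.
  rewrite [RHS]integral_mkcond; apply: eq_integral => u _.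
  rewrite patchE K1 subr_gt0 /K; case: ifPn => u0; last first.
    by rewrite memNset ?mul0r//= in_itv/= (negbTE u0).
  case: ifPn => u1; first by rewrite mem_set/= ?in_itv/= ?u0 ?mulr1.
  by rewrite memNset ?mulr0//= in_itv/= (negbTE u1) andbF.
(* The antiderivative is used only away from 0, so []0, 1]] is exhausted by [[1/(n+2), 1]] and
   monotone convergence applies; [n.+2] keeps the left end strictly below 1. *)
pose F (n : nat) : set R := `[n.+2%:R^-1, 1]%classic.
have F1 n : 0 < (n.+2%:R^-1 : R) < 1.
  by rewrite invr_gt0 ltr0n/= invf_lt1 ?ltr0n// ltr1n.
have -> : `]0%R, 1%R]%classic = \bigcup_n F n.
  apply/seteqP; split => t /=; rewrite in_itv/=.
    move=> /andP[t0 t1]; exists (Num.truncn t^-1) => //; rewrite /F/= in_itv/= t1 andbT.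
    rewrite invf_ple ?posrE ?ltr0n//.
    rewrite (le_trans (ltW (truncnS_gt _)))// ler_nat.
    exact: leqnSn.
  move=> [n _]; rewrite /F/= in_itv/= => /andP[nt ->]; rewrite andbT.
  by rewrite (lt_le_trans _ nt)//; case/andP: (F1 n).
have H : (\int[leb]_(t in F i) (t `^ (a - 1))%:E @[i --> \oo] -->
    \int[leb]_(t in \bigcup_i F i) (t `^ (a - 1))%:E)%E.
  apply: ge0_nondecreasing_set_cvg_integral.
  - apply/nondecreasing_seqP => n; rewrite subsetEset; apply: subset_itvr.
    by rewrite bnd_simp lef_pV2 ?posrE ?ltr0n// ler_nat.
  - by move=> i; exact: measurable_itv.
  - by move=> i; apply/measurable_EFinP/measurable_funTS; exact: measurable_powR.
  - by move=> i x _; rewrite lee_fin powR_ge0.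
rewrite -(cvg_lim _ H)//.
apply/cvg_lim => //.
under eq_fun do rewrite integral_powR_itv//.
apply: cvg_EFin; first by near=> n.
rewrite -[X in _ --> X]mul1r; apply: cvgMl.
rewrite -[X in _ --> X]subr0; apply: cvgB; first exact: cvg_cst.
have h : (fun n : nat => (n.+2%:R^-1 : R)) @ \oo --> (0 : R)^'+.
  move=> A [e /= e0 eA]; suff : \forall n \near \oo, A (n.+2%:R^-1) by [].
  near=> n; apply: eA => /=; last by rewrite invr_gt0.
  rewrite /ball/= sub0r normrN gtr0_norm ?invr_gt0//.
  rewrite (@le_lt_trans _ _ n.+1%:R^-1)//.
    by rewrite lef_pV2 ?posrE ?ltr0n// ler_nat.
  by near: n; exact: (near_infty_natSinv_lt (PosNum e0)).
exact: (cvg_comp _ _ h (powR_cvg0 a0)).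
Unshelve. all: by end_near.
Qed.


Definition ebeta (a b : R) : \bar R := (\int[leb]_t (K a t * K b (1 - t))%:E)%E.

Lemma egammaM a b : (egamma a * egamma b = egamma (a + b)%R * ebeta a b)%E.
Proof.
have := egamma_feynman a b 1 1 ltr01 ltr01; rewrite !powR1 !mul1e => ->.
congr (_ * _)%E; apply: eq_integral => t _.
by rewrite !mul1r subrKC powR1 mulr1.
Qed.

(** This is [egammaM] at [b = 1], where [egamma 1 = 1] and [ebeta a 1] is [1/a]; no integration by
    parts is involved. *)
Lemma egammaS a : 0 < a -> egamma (a + 1) = (a%:E * egamma a)%E.
Proof.
move=> a0; have := egammaM a 1; rewrite egamma1 mule1 => ->.
rewrite /ebeta integral_K_K1// muleC muleAC -muleA.
by rewrite -EFinM divff ?gt_eqF// mule1.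
Qed.

Lemma egamma_nat n : egamma n.+1%:R = (n`!%:R)%:E :> \bar R.
Proof.
elim: n => [|n IH]; first by rewrite egamma1.
by rewrite -[n.+2%:R]natr1 egammaS// IH -EFinM factS natrM.
Qed.

(** On [u > 0], [u^(a-1) <= 1 + u^n] for an integer [n] above [a], and the Gamma integrals of the
    two terms are 1 and [n!]. *)
Lemma egamma_ge1_fin a : 1 <= a -> (egamma a < +oo)%E.
Proof.
move=> a1; pose n := (Num.truncn a).+1.
apply: (@le_lt_trans _ _ (egamma 1 + egamma n.+1%:R)%E); last first.
  by rewrite egamma1 egamma_nat -EFinD ltry.
rewrite /egamma -ge0_integralD//; first last.
- by apply/measurable_EFinP; measR.
- by move=> u _; rewrite lee_fin; nneg.
- by apply/measurable_EFinP; measR.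
- by move=> u _; rewrite lee_fin; nneg.
apply: ge0_le_integral => //.
- by move=> u _; rewrite lee_fin; nneg.
- by apply/measurable_EFinP; measR.
- by apply: emeasurable_funD; apply/measurable_EFinP => /=; measR.
move=> u _; rewrite -EFinD lee_fin -mulrDl ler_wpM2r ?expR_ge0//.
have [u0|u0] := ltP 0 u; last by rewrite !K_le0// addr0.
rewrite K1 u0 !K_gt0E//; have [u1|u1] := leP u 1.
  rewrite (@le_trans _ _ 1) ?lerDl ?powR_ge0//.
  rewrite -[leRHS](powRr0 u); apply: ger_powR; first by rewrite u0.
  by rewrite subr_ge0.
rewrite (@le_trans _ _ (u `^ (n.+1%:R - 1))) ?lerDr//.
apply: ler_powR; first exact: ltW.
by rewrite lerB// ltW// (lt_trans (truncnS_gt a))// ltr_nat.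
Qed.

(** The functional equation carries finiteness from [a + 1 >= 1] down to [a]. *)
Lemma egamma_fin a : 0 < a -> (egamma a < +oo)%E.
Proof.
move=> a0; have : (egamma (a + 1) < +oo)%E by rewrite egamma_ge1_fin// lerDr ltW.
rewrite egammaS// !ltey; apply: contra => /eqP ->.
by rewrite gt0_muley ?lte_fin.
Qed.

Lemma egamma_gt0 a : (0 < egamma a)%E.
Proof.
(* A lower bound of the integrand on []1, 2[]: there [0 <= ln u <= 1], so [u^(a-1) >= exp(-|a-1|)],
   while [exp(-u) >= exp(-2)]. *)
pose c := expR (- `|a - 1| - 2).
have c0 : 0 < c by exact: expR_gt0.
apply: (@lt_le_trans _ _ (\int[leb]_u (c * (K 1 (u + -1) * K 1 (1 - (u + -1))))%:E)%E).
  rewrite (ge0_integral_shift (fun u => c * (K 1 u * K 1 (1 - u)))).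
  - by rewrite ge0_integralZl_real ?integral_K_K1 ?invr1 ?mule1 ?lte_fin ?ltW//;
      [measR|move=> x; nneg].
  - by measR.
  - by move=> x; apply: mulr_ge0; [exact: ltW|nneg].
apply: ge0_le_integral => //.
- by move=> u _; rewrite lee_fin; apply: mulr_ge0; [exact: ltW|nneg].
- by apply/measurable_EFinP; measR.
- by apply/measurable_EFinP; measR.
move=> u _; rewrite lee_fin !K1.
case: ifPn => [u1|_]; last by rewrite mul0r mulr0; nneg.
case: ifPn => [u2|_]; last by rewrite !mulr0; nneg.
have {}u1 : 1 < u by lra.
have {}u2 : u < 2 by lra.
have u0 : 0 < u by lra.
rewrite !mulr1 /c expRD K_gt0E//; apply: ler_pM; rewrite ?expR_ge0//; last first.
  by rewrite ler_expR lerN2 ltW.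
rewrite /powR gt_eqF// ler_expR.
have lu0 : 0 <= ln u by rewrite ln_ge0 ?ltW.
have lu1 : ln u <= 1.
  have := @le_ln1Dx R (u - 1); rewrite subrKC => H.
  by apply: (le_trans (H _)); lra.
rewrite lerNl -mulNr (le_trans (ler_norm _))// normrM normrN (ger0_norm lu0).
by rewrite ler_piMr.
Qed.

Lemma GammaE a : Gamma a = fine (egamma a).
Proof.
rewrite /Gamma /egamma Rintegral_mkcond /Rintegral; congr fine.
apply: eq_integral => u _; rewrite patchE /K; case: ifPn => u0.
  by rewrite (_ : 0 < u) //; move: u0; rewrite inE/= in_itv/= andbT.
rewrite ifF ?mul0r//; apply/negbTE; move: u0; rewrite notin_setE/= in_itv/= andbT.
by move/negP.
Qed.

Lemma egammaE a : 0 < a -> egamma a = (Gamma a)%:E.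
Proof.
by move=> a0; rewrite GammaE fineK// ge0_fin_numE ?egamma_fin ?egamma_ge0.
Qed.

Lemma Gamma_gt0 a : 0 < a -> 0 < Gamma a.
Proof. by move=> a0; rewrite -lte_fin -egammaE// egamma_gt0. Qed.

Lemma Gamma_neq0 a : 0 < a -> Gamma a != 0.
Proof. by move=> a0; exact: (lt0r_neq0 (Gamma_gt0 _ a0)). Qed.

Lemma GammaS a : 0 < a -> Gamma (a + 1) = a * Gamma a.
Proof.
by move=> a0; apply: EFin_inj; rewrite EFinM -!egammaE ?egammaS// addr_gt0.
Qed.

Lemma Gamma_nat n : Gamma n.+1%:R = n`!%:R :> R.
Proof. by apply: EFin_inj; rewrite -egammaE// egamma_nat. Qed.

(** [egamma_feynman] divided by Gamma(a + b), now known to be positive and finite. [A = B = 1] is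
    the Beta integral; unequal weights serve [integral_K3]. *)
Lemma feynman_integral a b (A B : R) : 0 < a -> 0 < b -> 0 < A -> 0 < B ->
  (\int[leb]_t (K a t * K b (1 - t) *
     (A * t + B * (1 - t)) `^ (- (a + b)))%:E =
   (A `^ (- a) * B `^ (- b) * (Gamma a * Gamma b / Gamma (a + b)))%:E)%E.
Proof.
move=> a0 b0 A0 B0; have ab0 : 0 < a + b by exact: addr_gt0.
have := egamma_feynman a b A B A0 B0; rewrite !egammaE// -!EFinM.
set I := (X in (_ * X)%E) => H.
have G0 := Gamma_gt0 _ ab0.
have : ((Gamma (a + b))^-1%:E * (Gamma (a + b))%:E * I = I)%E.
  by rewrite -EFinM mulVf ?gt_eqF// mul1e.
rewrite -muleA -H -EFinM => /esym E; etransitivity; first exact: E.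
by congr EFin; ring.
Qed.

Definition Beta (a b : R) : R := Gamma a * Gamma b / Gamma (a + b).

Lemma Beta_gt0 a b : 0 < a -> 0 < b -> 0 < Beta a b.
Proof.
by move=> a0 b0; rewrite /Beta divr_gt0 ?mulr_gt0 ?Gamma_gt0 ?addr_gt0.
Qed.

Lemma ebetaE a b : 0 < a -> 0 < b -> ebeta a b = (Beta a b)%:E.
Proof.
move=> a0 b0; have := feynman_integral a b 1 1 a0 b0 ltr01 ltr01.
rewrite !powR1 !mul1r /Beta => <-; apply: eq_integral => t _.
by rewrite !mul1r subrKC powR1 mulr1.
Qed.

End gamma_facts.

(** * Composition of fractional kernels *)

Section convolution.
Local Open Scope ring_scope.
Context {R : realType}.
Local Notation leb := (@lebesgue_measure R).
Implicit Types a b c x y z : R.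

Lemma BetaC a b : Beta a b = Beta b a.
Proof. by rewrite /Beta [Gamma a * _]mulrC [a + b]addrC. Qed.

Lemma Beta1 a : 0 < a -> Beta 1 a = a^-1.
Proof.
move=> a0; rewrite BetaC /Beta GammaS// (Gamma_nat 0) mulr1 invfM mulrCA.
by rewrite divff ?mulr1// gt_eqF// Gamma_gt0.
Qed.

Lemma ge0_integral_reflect_scale (f : R -> R) x c : 0 < c ->
  measurable_fun setT f -> (forall u, 0 <= f u) ->
  (\int[leb]_u (f u)%:E = \int[leb]_t (c * f (x - c * t))%:E)%E.
Proof.
move=> c0 mf f0.
have mfx : measurable_fun setT (fun u : R => f (x - u)).
  by apply: (measurableT_comp mf); measR.
rewrite ge0_integralZl_real//; last 2 first.
- exact: ltW.
- by apply: (measurableT_comp mf); measR.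
rewrite (ge0_integral_scale (fun u => f (x - u)))// ge0_integral_reflect//.
by rewrite muleA -EFinM divff ?gt_eqF// mul1e.
Qed.

(** The semigroup law at the level of kernels: [y = x - (x - z) t] turns the convolution into a Beta
    integral, and the powers of [x - z] collect. *)
Lemma integral_KK a b x z : 0 < a -> 0 < b ->
  (\int[leb]_y (K a (x - y) * K b (y - z))%:E =
   (Beta a b * K (a + b) (x - z))%:E)%E.
Proof.
move=> a0 b0; have [xz|xz] := ltP 0 (x - z); last first.
  rewrite (K_le0 (a + b))// mulr0 integral0_eq// => y _.
  have [xy|xy] := ltP 0 (x - y); last by rewrite K_le0 ?mul0r.
  by rewrite (K_le0 b) ?mulr0//; lra.
rewrite (ge0_integral_reflect_scale _ x _ xz); first last.
- by move=> y; nneg.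
- by measR.
rewrite EFinM -ebetaE// muleC -ge0_integralZl_real; first last.
- by move=> y; nneg.
- by measR.
- exact: K_ge0.
apply: eq_integral => t _; congr EFin.
rewrite (_ : x - (x - (x - z) * t) = (x - z) * t); last by ring.
rewrite (_ : x - (x - z) * t - z = (x - z) * (1 - t)); last by ring.
rewrite !K_scale// -!(K_gt0E _ (x - z))//.
have <- : (x - z) * (K a (x - z) * K b (x - z)) = K (a + b) (x - z).
  by rewrite KM KS; congr K; ring.
by ring.
Qed.

(** The substitution [z = y - (1 + y) t] gives [1 - z = 2 t + (1 - y)(1 - t)]. The exponent of
    [1 - z] is [-(a + b)], exactly the one for which the integral over [t] has the closed form of
    [feynman_integral], with weights 2 and [1 - y]. *)
Lemma integral_K3 a b y : 0 < a -> 0 < b -> y < 1 ->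
  (\int[leb]_z (K a (y - z) * (K b (1 + z) * K (1 - a - b) (1 - z)))%:E =
   (2 `^ (- a) * Beta a b * (K (1 - b) (1 - y) * K (a + b) (1 + y)))%:E)%E.
Proof.
move=> a0 b0 y1; have [yN|yN] := ltP 0 (1 + y); last first.
  rewrite (K_le0 (a + b))// !mulr0 integral0_eq// => z _.
  have [xy|xy] := ltP 0 (y - z); last by rewrite K_le0 ?mul0r.
  by rewrite (K_le0 b) ?mul0r ?mulr0//; lra.
rewrite (ge0_integral_reflect_scale _ y _ yN); first last.
- by move=> z; nneg.
- by measR.
have y1' : 0 < 1 - y by lra.
transitivity (\int[leb]_t (K (a + b) (1 + y) * (K a t * K b (1 - t) *
     (2 * t + (1 - y) * (1 - t)) `^ (- (a + b))))%:E)%E.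
  apply: eq_integral => t _; congr EFin.
  rewrite (_ : y - (y - (1 + y) * t) = (1 + y) * t); last by ring.
  rewrite (_ : 1 + (y - (1 + y) * t) = (1 + y) * (1 - t)); last by ring.
  rewrite (_ : 1 - (y - (1 + y) * t) = 2 * t + (1 - y) * (1 - t)); last by ring.
  rewrite !K_scale//.
  have [t0|t0] := ltP 0 t; last by rewrite (K_le0 a)// !(mulr0, mul0r).
  have [t1|t1] := ltP 0 (1 - t); last by rewrite (K_le0 b)// !(mulr0, mul0r).
  rewrite [K (1 - a - b) _]K_gt0E; last by rewrite addr_gt0// mulr_gt0.
  rewrite -!(K_gt0E _ (1 + y))//.
  rewrite (_ : 1 - a - b - 1 = - (a + b)); last by ring.
  have <- : (1 + y) * (K a (1 + y) * K b (1 + y)) = K (a + b) (1 + y).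
    by rewrite KM KS; congr K; ring.
  by ring.
rewrite ge0_integralZl_real; first last.
- by move=> z; nneg.
- by measR.
- exact: K_ge0.
rewrite feynman_integral// -EFinM; congr EFin.
rewrite [K (1 - b) _]K_gt0E// (_ : 1 - b - 1 = - b); last by ring.
by rewrite -/(Beta a b); ring.
Qed.

Lemma integral_kernel_comp (k1 k3 g : R -> R) (k2 : R -> R -> R) :
  measurable_fun setT k1 -> (forall y, 0 <= k1 y) ->
  measurable_fun setT g -> (forall y, 0 <= g y) ->
  measurable_fun setT (fun u : R * R => k2 u.1 u.2) ->
  (forall y z, 0 <= k2 y z) ->
  (forall z, \int[leb]_y (k1 y * k2 y z)%:E = (k3 z)%:E)%E ->
  (\int[leb]_y ((k1 y)%:E * \int[leb]_z (k2 y z * g z)%:E) =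
   \int[leb]_z (k3 z * g z)%:E)%E.
Proof.
move=> mk1 k10 mg g0 mk2 k20 k3E.
have mk2g : measurable_fun setT (fun u : R * R => k2 u.1 u.2 * g u.2).
  by apply: measurable_funM => //; apply: (measurableT_comp mg).
transitivity (\int[leb]_y \int[leb]_z (k1 y * (k2 y z * g z))%:E)%E.
  apply: eq_integral => y _; rewrite ge0_integralZl_real//.
  - exact: (measurable_fun_pair2 y mk2g).
  - by move=> z; exact: mulr_ge0.
rewrite tonelli_lebesgue; first last.
- by move=> y z; rewrite !mulr_ge0.
- by apply: measurable_funM => //; apply: (measurableT_comp mk1).
apply: eq_integral => z _.
transitivity (\int[leb]_y (g z * (k1 y * k2 y z))%:E)%E.
  by apply: eq_integral => y _; congr EFin; ring.
rewrite ge0_integralZl_real//; first last.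
- by move=> y; rewrite mulr_ge0.
- by apply: measurable_funM => //; exact: (measurable_fun_pair1 z mk2).
by rewrite k3E -EFinM mulrC.
Qed.

Lemma fracint_left_comp a b x (g : R -> R) : 0 < a -> 0 < b ->
  measurable_fun setT g -> (forall y, 0 <= g y) ->
  (\int[leb]_y ((K a (x - y))%:E * \int[leb]_z (K b (y - z) * g z)%:E) =
   (Beta a b)%:E * \int[leb]_z (K (a + b) (x - z) * g z)%:E)%E.
Proof.
move=> a0 b0 mg g0.
rewrite (integral_kernel_comp _ (fun z => Beta a b * K (a + b) (x - z)) _
  (fun y z => K b (y - z)))//.
- rewrite -ge0_integralZl_real//.
  + by apply: eq_integral => z _; rewrite mulrA.
  + exact/ltW/Beta_gt0.
  + by apply: measurable_funM => //; measR.
  + by move=> z; rewrite mulr_ge0//; nneg.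
- by measR.
- by move=> y; nneg.
- by measR.
- by move=> y z; nneg.
- by move=> z; exact: integral_KK.
Qed.

Lemma fracint_right_comp a b x (g : R -> R) : 0 < a -> 0 < b ->
  measurable_fun setT g -> (forall y, 0 <= g y) ->
  (\int[leb]_y ((K a (y - x))%:E * \int[leb]_z (K b (z - y) * g z)%:E) =
   (Beta a b)%:E * \int[leb]_z (K (a + b) (z - x) * g z)%:E)%E.
Proof.
move=> a0 b0 mg g0.
rewrite (integral_kernel_comp _ (fun z => Beta a b * K (a + b) (z - x)) _
  (fun y z => K b (z - y)))//.
- rewrite -ge0_integralZl_real//.
  + by apply: eq_integral => z _; rewrite mulrA.
  + exact/ltW/Beta_gt0.
  + by apply: measurable_funM => //; measR.
  + by move=> z; rewrite mulr_ge0//; nneg.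
- by measR.
- by move=> y; nneg.
- by measR.
- by move=> y z; nneg.
- move=> z; have := integral_KK b a z x b0 a0; rewrite BetaC [b + a]addrC => <-.
  by apply: eq_integral => y _; rewrite mulrC.
Qed.

End convolution.

(** * Partial fractions of the cosecant, with an error bound *)

Section cosecant_series.
Local Open Scope ring_scope.
Context {R : realType}.
Implicit Types (s t u v : R) (N : nat).

Lemma ge0_derive_ge (f df : R -> R) : (forall x : R, is_derive x 1 f (df x)) ->
  (forall x, 0 < x -> 0 <= df x) -> forall x, 0 <= x -> f 0 <= f x.
Proof.
move=> fdf df0 x; rewrite le_eqVlt => /predU1P[<-//|x0].
have [|c] := @MVT R f df 0 x x0 (fun y _ => fdf y).
  apply: derivable_within_continuous => y _; exact: ex_derive.
rewrite in_itv/= => /andP[c0 _] E.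
by rewrite -subr_ge0 E mulr_ge0 ?df0// subr0 ltW.
Qed.

(** First of three Taylor bounds: in [cos_ge_quad] and [sin_ge_cubic] the derivative of the
    difference is the difference of the preceding bound. *)
Lemma sin_le u : 0 <= u -> sin u <= u.
Proof.
move=> u0; have := @ge0_derive_ge (fun u => u - sin u) (fun u => 1 - cos u) _ _ u u0.
rewrite sin0 subrr => H; rewrite -subr_ge0; apply: H => x _.
by rewrite subr_ge0 cos_le1.
Qed.

Lemma cos_ge_quad u : 0 <= u -> 1 - u ^+ 2 / 2 <= cos u.
Proof.
move=> u0; have := @ge0_derive_ge (fun u => cos u + u ^+ 2 / 2 - 1)
  (fun u => u - sin u) _ _ u u0.
rewrite cos0 => H.
suff : 0 <= cos u + u ^+ 2 / 2 - 1 by lra.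
apply: le_trans (H _ _); first by lra.
  move=> x; apply: trigger_derive; rewrite /GRing.scale/=; lra.
by move=> x x0; rewrite subr_ge0 sin_le// ltW.
Qed.

Lemma sin_ge_cubic u : 0 <= u -> u - u ^+ 3 / 6 <= sin u.
Proof.
move=> u0; have := @ge0_derive_ge (fun u => sin u + u ^+ 3 / 6 - u)
  (fun u => cos u + u ^+ 2 / 2 - 1) _ _ u u0.
rewrite sin0 => H.
suff : 0 <= sin u + u ^+ 3 / 6 - u by lra.
apply: le_trans (H _ _); first by lra.
  move=> x; apply: trigger_derive; rewrite /GRing.scale/=; lra.
by move=> x x0; have := @cos_ge_quad x (ltW x0); lra.
Qed.

(** The cotangent without its pole at 0, hence Lipschitz up to [pi / 2]. *)
Definition cotB u : R := cos u / sin u - u^-1.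

Lemma cotB_lipschitz u v : 0 < u < pi / 2 -> 0 < v < pi / 2 ->
  `|cotB u - cotB v| <= 3 * `|u - v|.
Proof.
wlog uv : u v / u < v => [H|].
  move=> hu hv; have [uv|uv|->] := ltgtP u v.
  - exact: H.
  - by rewrite distrC [`|u - v|]distrC; exact: H.
  - by rewrite !subrr normr0 mulr0.
move=> /andP[u0 _] /andP[_ v2].
have pi4 : pi / 2 < 2 :> R := pihalf_lt2 R.
have sinB (x : R) : 0 < x -> x < 2 -> x / 3 <= sin x.
  move=> x0 x2; apply: le_trans (sin_ge_cubic _ (ltW x0)).
  suff : x ^+ 3 <= 4 * x by lra.
  by rewrite exprSr ler_wpM2r ?ltW//; nra.
pose df (x : R) : R := (x ^+ 2)^-1 - (sin x ^+ 2)^-1.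
have dF' (x : R) : 0 < x < pi / 2 -> is_derive x 1 cotB (df x).
  move=> /andP[x0 xv].
  have sx : sin x != 0 by rewrite gt_eqF// (lt_le_trans _ (sinB _ _ _))//; lra.
  have dx : is_derive x 1 (fun t : R => t^-1) (- x ^- 2 *: 1).
    by apply: is_deriveV; rewrite gt_eqF.
  have ds : is_derive x 1 (fun t : R => (sin t)^-1) (- sin x ^- 2 *: cos x).
    exact: is_deriveV.
  rewrite /cotB; apply: is_derive_eq; rewrite /GRing.scale/= /df.
  transitivity (- (cos x ^+ 2 / sin x ^+ 2) - 1 + (x ^+ 2)^-1).
    by field; rewrite sx gt_eqF.
  by rewrite cos2sin2; field; rewrite sx gt_eqF.
have dF (x : R) : x \in `]u, v[ -> is_derive x 1 cotB (df x).
  by rewrite in_itv/= => /andP[ux xv]; apply: dF'; rewrite (lt_trans u0)//= (lt_trans xv).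
have [|c] := MVT uv dF.
  apply: derivable_within_continuous => y; rewrite in_itv/= => /andP[uy yv].
  have [|] := dF' y; last by [].
  by rewrite (lt_le_trans u0 uy)/= (le_lt_trans yv).
rewrite in_itv/= => /andP[uc cv].
move=> E; rewrite distrC [`|u - v|]distrC E normrM ler_wpM2r//.
have c0 : 0 < c by exact: lt_trans uc.
have c2 : c < 2 by lra.
have h1 := sinB _ c0 c2.
have h2 := sin_le _ (ltW c0).
have h3 := sin_ge_cubic _ (ltW c0).
have s0 : 0 < sin c by lra.
rewrite /df distrC ger0_norm; last first.
  by rewrite subr_ge0 lef_pV2 ?posrE ?exprn_gt0// ler_pXn2r ?nnegrE// ltW.
rewrite (_ : (sin c ^+ 2)^-1 - (c ^+ 2)^-1 =
   (c ^+ 2 - sin c ^+ 2) / (sin c ^+ 2 * c ^+ 2)); last first.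
  by field; rewrite !gt_eqF.
rewrite ler_pdivrMr ?mulr_gt0 ?exprn_gt0//.
(* Here [c - sin c <= c^3/6] and [c + sin c <= 2c]. The product [c^4/3] equals [3 (c/3)^2 c^2], and
   [c/3 <= sin c]: this is the constant 3. *)
apply: (@le_trans _ _ (c ^+ 3 / 6 * (2 * c))).
  rewrite subr_sqr; apply: ler_pM; lra.
apply: (@le_trans _ _ (3 * ((c / 3) ^+ 2 * c ^+ 2))).
  by rewrite le_eqVlt; apply/orP; left; apply/eqP; field.
rewrite ler_wpM2l// ler_wpM2r ?exprn_ge0 ?(ltW c0)//.
by rewrite ler_pXn2r ?nnegrE//; lra.
Qed.



(* By the duplication formula, doubling [N] halves the Lipschitz constant of
   [cotrem N] on ]0, 1[, and the partial sums of the cosecant series differ from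
   [pi / sin (pi s)] by an increment of [cotrem N]. *)
Definition cotrem N s : R := pi * (cos (pi * s) / sin (pi * s)) -
  \sum_(k < N) ((k%:R + s)^-1 - (k%:R + 1 - s)^-1).

Lemma sin_cos_half s : 0 < s < 1 ->
  sin (pi * s / 2) != 0 /\ cos (pi * s / 2) != 0.
Proof.
move=> /andP[s0 s1]; have p0 := pi_gt0 R.
have h : pi * s / 2 < pi / 2 by rewrite ltr_pM2r// gtr_pMr.
have h0 : 0 < pi * s / 2 by rewrite divr_gt0// mulr_gt0.
split; rewrite gt_eqF//; first by apply: sin_gt0_pihalf; rewrite h0.
by apply: cos_gt0_pihalf; rewrite h (lt_trans _ h0)// oppr_lt0 divr_gt0.
Qed.

(** With [w = pi s / 2], [cot(2w) = (cot w - tan w) / 2] and [tan w = cot(pi/2 - w)]; the terms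
    [1/s] and [1/(1 - s)] are the poles that [cotB] removes. *)
Lemma cotrem1E s : 0 < s < 1 ->
  cotrem 1 s = pi / 2 * (cotB (pi / 2 * s) - cotB (pi / 2 * (1 - s))).
Proof.
move=> s01; have [sn cn] := sin_cos_half _ s01; move: s01 => /andP[s0 s1].
have p0 : pi != 0 :> R by rewrite gt_eqF// pi_gt0.
rewrite /cotrem big_ord_recl big_ord0 /= mulr0n addr0 !add0r.
rewrite /cotB.
have -> : pi / 2 * (1 - s) = - (pi * s / 2 - pi / 2) by field.
rewrite cosN sinN cosBpihalf sinBpihalf opprK.
have -> : - (pi * s / 2 - pi / 2) = pi / 2 * (1 - s) by field.
have -> : pi / 2 * s = pi * s / 2 by field.
have -> : pi * s = pi * s / 2 + pi * s / 2 by field.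
rewrite sinD cosD.
have -> : pi * s / 2 + pi * s / 2 = pi * s by field.
have E1 : pi / 2 * (pi * s / 2)^-1 = s^-1.
  rewrite (_ : pi * s / 2 = pi / 2 * s); last by field.
  by rewrite invfM mulrA divff ?mul1r// mulf_neq0// invr_neq0.
have E2 : pi / 2 * (pi / 2 * (1 - s))^-1 = (1 - s)^-1.
  by rewrite invfM mulrA divff ?mul1r// mulf_neq0// invr_neq0.
set w := pi / 2 * (1 - s) in E2 *.
rewrite !mulrBr E1 E2.
set u := cos _ in cn *; set v := sin _ in sn *.
have -> : (u * u - v * v) / (v * u + u * v) = (u / v - v / u) / 2.
  have -> : v * u + u * v = 2 * (u * v) by ring.
  by field; rewrite ?sn ?cn.
by ring.
Qed.

Lemma cotrem1_lipschitz s t : 0 < s < 1 -> 0 < t < 1 ->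
  `|cotrem 1 s - cotrem 1 t| <= 3 / 2 * pi ^+ 2 * `|s - t|.
Proof.
move=> hs ht; rewrite !cotrem1E//.
have p0 := pi_gt0 R.
have p20 : 0 < pi / 2 :> R by rewrite divr_gt0.
have hp (r : R) : 0 < r < 1 -> 0 < pi / 2 * r < pi / 2.
  by move=> /andP[r0 r1]; rewrite mulr_gt0//= gtr_pMr.
have hs' : 0 < 1 - s < 1 by lra.
have ht' : 0 < 1 - t < 1 by lra.
have H1 := cotB_lipschitz _ _ (hp _ hs) (hp _ ht).
have H2 := cotB_lipschitz _ _ (hp _ hs') (hp _ ht').
rewrite -mulrBr normrM gtr0_norm// (le_trans (ler_wpM2l (ltW p20)
  (_ : _ <= 3 * `|pi / 2 * s - pi / 2 * t| + 3 * `|pi / 2 * (1 - s) - pi / 2 * (1 - t)|)))//.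
  apply: le_trans (lerD H1 H2).
  apply: le_trans (ler_normB _ _); rewrite le_eqVlt; apply/orP; left; apply/eqP.
  by congr (`|_|); ring.
rewrite -!mulrBr !(normrM (pi / 2)) !(gtr0_norm p20).
rewrite (_ : 1 - s - (1 - t) = - (s - t)) ?normrN; last by ring.
by rewrite le_eqVlt; apply/orP; left; apply/eqP; field.
Qed.

Lemma sum_double (V : zmodType) (g : nat -> V) N :
  \sum_(k < N.*2) g k = \sum_(k < N) (g k.*2 + g k.*2.+1).
Proof.
elim: N => [|N IH]; first by rewrite !big_ord0.
by rewrite doubleS !big_ord_recr/= IH addrA.
Qed.

(** The sums at [s/2] and [(s + 1)/2] supply the terms of even and odd index of the doubled sum,
    each up to a factor 2. *)
Lemma cotrem_double N s : 0 < s < 1 ->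
  cotrem N.*2 s = (cotrem N (s / 2) + cotrem N ((s + 1) / 2)) / 2.
Proof.
move=> s01; have [sn cn] := sin_cos_half _ s01; move: s01 => /andP[s0 s1].
rewrite /cotrem (sum_double _ (fun k => (k%:R + s)^-1 - (k%:R + 1 - s)^-1)).
rewrite (_ : pi * ((s + 1) / 2) = pi * s / 2 + pi / 2); last by field.
rewrite cosDpihalf sinDpihalf.
rewrite (_ : pi * (s / 2) = pi * s / 2); last by field.
rewrite (_ : pi * s = pi * s / 2 + pi * s / 2); last by field.
rewrite sinD cosD.
rewrite (_ : pi * s / 2 + pi * s / 2 = pi * s); last by field.
set c := cos _ in cn *; set d := sin _ in sn *.
rewrite [in RHS]addrACA -opprD -big_split /= [RHS]mulrBl; congr (_ - _).
  have -> : d * c + c * d = 2 * (c * d) by ring.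
  by field; rewrite ?sn ?cn.
rewrite big_distrl /=; apply: eq_bigr => k _.
have k0 : 0 <= k%:R :> R by exact: ler0n.
rewrite -[k.*2.+1%:R]natr1 -mul2n natrM.
by field; rewrite !lt0r_neq0//; lra.
Qed.

Lemma cotrem_lipschitz j s t : 0 < s < 1 -> 0 < t < 1 ->
  `|cotrem (2 ^ j) s - cotrem (2 ^ j) t| <= 3 / 2 * pi ^+ 2 * 2 ^- j * `|s - t|.
Proof.
elim: j s t => [|j IH] s t hs ht.
  by rewrite expn0 expr0 invr1 mulr1 cotrem1_lipschitz.
rewrite expnS mul2n !cotrem_double//.
have half (r : R) : 0 < r < 1 -> (0 < r / 2 < 1) * (0 < (r + 1) / 2 < 1).
  by move=> hr; split; lra.
have H1 := IH _ _ (half _ hs).1 (half _ ht).1.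
have H2 := IH _ _ (half _ hs).2 (half _ ht).2.
rewrite -mulrBl normrM opprD addrACA [`|2^-1|]ger0_norm ?invr_ge0//.
apply: (le_trans (ler_wpM2r _ (ler_normD _ _))); first by rewrite invr_ge0.
apply: (le_trans (ler_wpM2r _ (lerD H1 H2))); first by rewrite invr_ge0.
rewrite (_ : (s + 1) / 2 - (t + 1) / 2 = (s - t) / 2); last by field.
rewrite (_ : s / 2 - t / 2 = (s - t) / 2); last by field.
rewrite normrM [`|2^-1|]ger0_norm ?invr_ge0// [2 ^+ j.+1]exprS invfM.
by set q := (2 ^+ j)^-1; lra.
Qed.

(** The alternating series of [pi / sin(pi s)], grouped in pairs and by the poles at [s] and
    [1 - s], the shape in which [reta_sum] produces it. *)
Definition cscsum N s : R := \sum_(k < N)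
  ((s + k.*2%:R)^-1 - (s + k.*2.+1%:R)^-1 +
   ((1 - s + k.*2%:R)^-1 - (1 - s + k.*2.+1%:R)^-1)).

(** With [w = pi s / 2]: [2 / sin(2w) = cot w + tan w] and [cot(w + pi/2) = - tan w]. *)
Lemma csc_cotrem N s : 0 < s < 1 ->
  pi / sin (pi * s) - cscsum N s = (cotrem N (s / 2) - cotrem N ((s + 1) / 2)) / 2.
Proof.
move=> s01; have [sn cn] := sin_cos_half _ s01; move: s01 => /andP[s0 s1].
rewrite /cotrem.
rewrite (_ : pi * ((s + 1) / 2) = pi * s / 2 + pi / 2); last by field.
rewrite cosDpihalf sinDpihalf.
rewrite (_ : pi * (s / 2) = pi * s / 2); last by field.
rewrite (_ : pi * s = pi * s / 2 + pi * s / 2); last by field.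
rewrite sinD.
rewrite (_ : pi * s / 2 + pi * s / 2 = pi * s); last by field.
have := cos2Dsin2 (pi * s / 2).
set c := cos _ in cn *; set d := sin _ in sn * => cd.
set S1 := \sum_(k < N) _; set S2 := \sum_(k < N) _.
transitivity ((pi * (c / d) - pi * (- d / c)) / 2 - (S1 - S2) / 2); last by ring.
congr (_ - _).
  have -> : d * c + c * d = 2 * (c * d) by ring.
  rewrite (_ : pi / _ = pi * (c ^+ 2 + d ^+ 2) / (2 * (c * d))); last by rewrite cd mulr1.
  by field; rewrite ?sn ?cn.
rewrite -sumrB big_distrl /=; apply: eq_bigr => k _.
have k0 : 0 <= k%:R :> R by exact: ler0n.
rewrite -[k.*2.+1%:R]natr1 -mul2n natrM.
by field; rewrite !lt0r_neq0//; lra.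
Qed.

Lemma csc_approx j s : 0 < s < 1 ->
  `|pi / sin (pi * s) - cscsum (2 ^ j) s| <= 3 / 2 * pi ^+ 2 * 2 ^- j.
Proof.
move=> s01; rewrite csc_cotrem// normrM [`|2^-1|]ger0_norm ?invr_ge0//.
have C0 : 0 <= 3 / 2 * pi ^+ 2 * 2 ^- j :> R.
  by rewrite !mulr_ge0 ?invr_ge0 ?exprn_ge0// pi_ge0.
have s1 : 0 < s / 2 < 1 by lra.
have s2 : 0 < (s + 1) / 2 < 1 by lra.
have := cotrem_lipschitz j _ _ s1 s2.
rewrite (_ : s / 2 - (s + 1) / 2 = - 2^-1); last by field.
rewrite normrN [`|2^-1|]ger0_norm ?invr_ge0//.
move: C0; set C := _ * _; lra.
Qed.

End cosecant_series.

(** * Euler's reflection formula *)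

Section reflection.
Local Open Scope ring_scope.
Context {R : realType}.
Local Notation leb := (@lebesgue_measure R).
Implicit Types a s : R.

(** The integral of [t^(a-1) / (1 + t)] over []0, 1[]. The values at [s] and [1 - s] are the two
    halves, cut at [t = 1], of the classical integral for Gamma(s) Gamma(1 - s). *)
Definition eta (a : R) : \bar R :=
  (\int[leb]_t (K a t * K 1 (1 - t) * (1 + t) `^ (- 1))%:E)%E.

Lemma eta_ge0 a : (0 <= eta a)%E.
Proof. by apply: integral_ge0 => u _; rewrite lee_fin; nneg. Qed.

Lemma etaD a : 0 < a -> (eta a + eta (a + 1)%R = a^-1%:E)%E.
Proof.
move=> a0; rewrite -ge0_integralD//; first last.
- by apply/measurable_EFinP; measR.
- by move=> u _; rewrite lee_fin; nneg.
- by apply/measurable_EFinP; measR.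
- by move=> u _; rewrite lee_fin; nneg.
rewrite -integral_K_K1//; apply: eq_integral => t _.
rewrite -EFinD -KS; congr EFin.
have [t0|t0] := ltP 0 t; last by rewrite K_le0// !(mul0r, mulr0, addr0).
rewrite powR_inv1; last by lra.
by field; rewrite gt_eqF//; lra.
Qed.

Lemma eta_fin a : 0 < a -> eta a \is a fin_num.
Proof.
move=> a0; rewrite ge0_fin_numE ?eta_ge0// (@le_lt_trans _ _ a^-1%:E) ?ltry//.
by rewrite -etaD// leeDl ?eta_ge0.
Qed.

Definition reta a : R := fine (eta a).

Lemma retaD a : 0 < a -> reta a + reta (a + 1) = a^-1.
Proof.
move=> a0; have := etaD _ a0; rewrite -[eta a]fineK ?eta_fin//.
by rewrite -[eta (a + 1)]fineK ?eta_fin ?addr_gt0// -EFinD => -[].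
Qed.

Lemma reta_itv a : 0 < a -> 0 <= reta a <= a^-1.
Proof.
move=> a0; have h b : 0 <= reta b by rewrite fine_ge0// eta_ge0.
by rewrite h -retaD// lerDl h.
Qed.

(** Iterating [retaD] replaces a geometric series under the integral; the remainder is at most
    [1/(a + 2N)] by [reta_itv]. *)
Lemma reta_sum a N : 0 < a ->
  reta a = \sum_(k < N) ((a + k.*2%:R)^-1 - (a + k.*2.+1%:R)^-1) +
           reta (a + N.*2%:R).
Proof.
move=> a0; elim: N => [|N IH]; first by rewrite big_ord0 add0r addr0.
rewrite IH big_ord_recr/= -!addrA; congr (_ + _).
have h0 : 0 < a + N.*2%:R by rewrite ltr_wpDr.
have h1 : 0 < a + N.*2.+1%:R by rewrite ltr_wpDr.
have := retaD _ h0; have := retaD _ h1; rewrite -!addrA !natr1 doubleS.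
move: (reta (a + N.*2%:R)) (reta (a + N.*2.+1%:R)) (reta (a + N.*2.+2%:R)).
by move=> r0 r1 r2 <- <-; ring.
Qed.

Lemma reta_csc s : 0 < s < 1 -> reta s + reta (1 - s) = pi / sin (pi * s).
Proof.
move=> /andP[s0 s1]; have s1' : 0 < 1 - s by lra.
apply/eqP; rewrite -subr_eq0 -normr_eq0; apply/eqP/le_anti; rewrite normr_ge0 andbT.
have C0 : 0 <= 3 / 2 * pi ^+ 2 + 1 :> R.
  by rewrite addr_ge0// !mulr_ge0// ?exprn_ge0// pi_ge0.
(* The term with [pi ^+ 2] is the error of [csc_approx]; the added 1 covers two remainders, each at
   most [1/(2N)] with [N = 2 ^ j]. *)
suff H j : `|reta s + reta (1 - s) - pi / sin (pi * s)| <=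
    (3 / 2 * pi ^+ 2 + 1) * (2 ^- j).
  apply/ler_addgt0Pr => e e0; rewrite add0r.
  have hj : (3 / 2 * pi ^+ 2 + 1) / e < (Num.truncn ((3 / 2 * pi ^+ 2 + 1) / e)).+1%:R.
    exact: truncnS_gt.
  apply: (le_trans (H (Num.truncn ((3 / 2 * pi ^+ 2 + 1) / e)).+1)).
  rewrite ler_pdivrMr ?exprn_gt0// [e * _]mulrC -ler_pdivrMr//.
  rewrite (le_trans (ltW hj))// -natrX ler_nat ltnW//.
  exact: ltn_expl.
have := @csc_approx R j s; rewrite s0 s1 => /(_ isT).
set P := pi / _; set C := 3 / 2 * _.
set N := (2 ^ j)%N => H.
have N0 : 0 < N%:R :> R by rewrite ltr0n expn_gt0.
have NE : N%:R = 2 ^+ j :> R by rewrite natrX.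
rewrite (reta_sum _ N s0) (reta_sum _ N s1') addrACA -big_split/= -/(cscsum N s).
have h (b : R) : 0 < b -> 0 <= reta (b + N.*2%:R) <= (N%:R)^-1 / 2.
  move=> b0; have b1 : 0 < b + N.*2%:R by rewrite ltr_wpDr.
  have /andP[-> h] /= := reta_itv _ b1; apply: (le_trans h).
  rewrite -invfM lef_pV2 ?posrE ?mulr_gt0//.
  by rewrite -muln2 natrM; lra.
have h1 := h _ s0; have h2 := h _ s1'.
move: H h1 h2; rewrite mulrDl mul1r -NE !ler_norml.
move: (reta (s + _)) (reta (1 - s + _)) (cscsum N s) P C (N%:R^-1).
by clear; move=> r1 r2 S P C q; lra.
Qed.

(** After [u = v t] all powers of [v] cancel, and integrating [exp(-(1 + t) v)] over [v > 0] leaves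
    [1/(1 + t)]. *)
Lemma eta_triangle a : 0 < a < 1 ->
  (\int[leb]_v \int[leb]_u
     (K 1 (v - u) * (K a u * expR (- u) * (K (1 - a) v * expR (- v))))%:E = eta a)%E.
Proof.
move=> /andP[a0 a1].
transitivity (\int[leb]_v \int[leb]_t
    (K a t * K 1 (1 - t) * (K 1 v * expR (- ((1 + t) * v))))%:E)%E.
  apply: eq_integral => v _; have [v0|v0] := ltP 0 v; last first.
    rewrite !integral0_eq// => u _; first by rewrite (K_le0 1 v)// !(mul0r, mulr0).
    by rewrite (K_le0 (1 - a))// !(mul0r, mulr0).
  rewrite -[LHS]mul1e (_ : 1%E = (v * v^-1)%:E); last by rewrite divff// gt_eqF.
  rewrite EFinM -muleA.
  rewrite -(ge0_integral_scale (fun u =>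
    K 1 (v - u) * (K a u * expR (- u) * (K (1 - a) v * expR (- v)))))//; first last.
  - by move=> u; nneg.
  - by measR.
  rewrite -ge0_integralZl_real; first last.
  - by move=> u; nneg.
  - by measR.
  - exact: ltW.
  apply: eq_integral => t _; congr EFin.
  have -> : v - v * t = v * (1 - t) by ring.
  have -> : - ((1 + t) * v) = - (v * t) + - v by ring.
  rewrite expRD !K_scale// -!(K_gt0E _ v)//.
  have E : v * (K a v * K (1 - a) v) = 1.
    rewrite KM KS (_ : a + (1 - a) - 1 + 1 = 1); last by ring.
    by rewrite K1 v0.
  rewrite (K1 v) v0 mul1r.
  transitivity (v * (K a v * K (1 - a) v) *
     (K 1 (1 - t) * (K a t * (expR (- (v * t)) * expR (- v))))); last first.
    by rewrite E; ring.
  by ring.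
rewrite tonelli_lebesgue; first last.
- by move=> x y; nneg.
- by measR.
apply: eq_integral => t _.
rewrite ge0_integralZl_real; first last.
- by move=> x; nneg.
- by measR.
- by nneg.
have [t0|t0] := ltP 0 t; last by rewrite (K_le0 a)// !mul0r !mul0e.
by rewrite egamma_scale ?egamma1 ?mule1 -?EFinM//; lra.
Qed.

Lemma integral_offdiag (f : R -> R) u : measurable_fun setT f -> (forall v, 0 <= f v) ->
  (\int[leb]_v (f v)%:E = \int[leb]_v (K 1 (v - u) * f v)%:E +
                          \int[leb]_v (K 1 (u - v) * f v)%:E)%E.
Proof.
move=> mf f0; rewrite -ge0_integralD//; first last.
- by apply/measurable_EFinP; apply: measurable_funM => //; measR.
- by move=> v _; rewrite lee_fin; apply: mulr_ge0 => //; nneg.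
- by apply/measurable_EFinP; apply: measurable_funM => //; measR.
- by move=> v _; rewrite lee_fin; apply: mulr_ge0 => //; nneg.
transitivity (\int[leb]_(v in setT `\ u) (f v)%:E)%E.
  apply/esym/integral_setD1; first exact: measurableD.
  by apply/measurable_EFinP; exact: measurable_funTS.
rewrite [LHS]integral_mkcond; apply: eq_integral => v _.
rewrite patchE !K1 !subr_gt0 -EFinD; case: (ltgtP v u) => [uv|uv|->].
- by rewrite mem_set ?mul0r ?mul1r ?add0r//=; split => //; apply/eqP; rewrite lt_eqF.
- by rewrite mem_set ?mul0r ?mul1r ?addr0//=; split => //; apply/eqP; rewrite gt_eqF.
- by rewrite memNset ?mul0r ?addr0//= => -[_]; exact.
Qed.

Lemma iterated_integralD (f g : R -> R -> R) :
  measurable_fun setT (fun z : R * R => f z.1 z.2) ->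
  measurable_fun setT (fun z : R * R => g z.1 z.2) ->
  (forall x y, 0 <= f x y) -> (forall x y, 0 <= g x y) ->
  (\int[leb]_x (\int[leb]_y (f x y)%:E + \int[leb]_y (g x y)%:E) =
   \int[leb]_x \int[leb]_y (f x y)%:E + \int[leb]_x \int[leb]_y (g x y)%:E)%E.
Proof.
move=> mf mg f0 g0.
have ge0 (h : R -> R -> R) : (forall x y, 0 <= h x y) ->
    forall x, setT x -> (0 <= \int[leb]_y (h x y)%:E)%E.
  by move=> h0 x _; apply: integral_ge0 => y _; rewrite lee_fin.
have mh (h : R -> R -> R) : measurable_fun setT (fun z : R * R => h z.1 z.2) ->
    (forall x y, 0 <= h x y) ->
    measurable_fun setT (fun x => \int[leb]_y (h x y)%:E)%E.
  move=> hm h0.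
  apply: (@measurable_fun_fubini_tonelli_F _ _ _ _ R leb (fun z => (h z.1 z.2)%:E)).
    exact/measurable_EFinP.
  by move=> z; rewrite lee_fin.
by apply: ge0_integralD => //; [exact: ge0|exact: mh|exact: ge0|exact: mh].
Qed.

(** The quadrant is cut along its null diagonal; exchanging variables in one triangle gives both the
    same shape, with [f] and [g] swapped. *)
Lemma integralM_triangles (f g : R -> R) :
  measurable_fun setT f -> (forall x, 0 <= f x) ->
  measurable_fun setT g -> (forall x, 0 <= g x) ->
  ((\int[leb]_x (f x)%:E) * (\int[leb]_y (g y)%:E) =
   \int[leb]_v \int[leb]_u (K 1 (v - u) * (f u * g v))%:E +
   \int[leb]_v \int[leb]_u (K 1 (v - u) * (g u * f v))%:E)%E.
Proof.
move=> mf f0 mg g0; rewrite ge0_integralM_real//.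
have mF : measurable_fun setT (fun z : R * R => f z.1 * g z.2).
  by apply: measurable_funM; [exact: (measurableT_comp mf)|exact: (measurableT_comp mg)].
have mk1 : measurable_fun setT (fun z : R * R => K 1 (z.2 - z.1)) by measR.
have mk2 : measurable_fun setT (fun z : R * R => K 1 (z.1 - z.2)) by measR.
have fg0 u v : 0 <= f u * g v by exact: mulr_ge0.
have F1 u v : 0 <= K 1 (v - u) * (f u * g v) by rewrite mulr_ge0// K_ge0.
have F2 u v : 0 <= K 1 (u - v) * (f u * g v) by rewrite mulr_ge0// K_ge0.
have mF1 := measurable_funM mk1 mF.
have mF2 := measurable_funM mk2 mF.
transitivity (\int[leb]_u (\int[leb]_v (K 1 (v - u) * (f u * g v))%:E +
                           \int[leb]_v (K 1 (u - v) * (f u * g v))%:E))%E.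
  apply: eq_integral => u _; apply: (integral_offdiag (fun v => f u * g v)).
  - exact: measurable_funM.
  - by [].
etransitivity; first exact: (iterated_integralD _ _ mF1 mF2 F1 F2).
apply: (f_equal2 adde); first exact: (tonelli_lebesgue _ mF1 F1).
by apply: eq_integral => u _; apply: eq_integral => v _; rewrite [g v * _]mulrC.
Qed.

Lemma Gamma_reflection s : 0 < s < 1 ->
  Gamma s * Gamma (1 - s) = pi / sin (pi * s).
Proof.
move=> s01; have /andP[s0 s1] := s01.
have s1' : 0 < 1 - s by lra.
have s01' : 0 < 1 - s < 1 by lra.
rewrite -reta_csc//; apply: EFin_inj; rewrite EFinM -!egammaE//.
rewrite EFinD /reta !fineK ?eta_fin//.
rewrite integralM_triangles; first last.
- by move=> x; nneg.
- by measR.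
- by move=> x; nneg.
- by measR.
rewrite eta_triangle//.
by have := eta_triangle _ s01'; rewrite subKr => ->.
Qed.

End reflection.

(** * The two-sided integral of the bare weight is constant *)

Section two_sided_moments.
Local Open Scope ring_scope.
Context {R : realType}.
Local Notation leb := (@lebesgue_measure R).
Variables (p s mu nu : R).
Hypotheses (hp : 0 <= p <= 1) (hs : 0 < s < 1).
Hypotheses (hmu : - s <= mu <= 0) (hnu : - s <= nu <= 0) (hsum : mu + nu = - s).
Hypothesis hsin : p * sin (pi * mu) = (1 - p) * sin (pi * nu).
Implicit Types x y z t : R.

Ltac slra := move: (hp) (hs) (hmu) (hnu) (hsum) => ? ? ? ? ?; lra.


(** The weight times [(1 + y)^m], extended by 0 outside []-1, 1[]; the shifts by 1 undo the exponent
    [a - 1] in [K a]. *)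
Definition wJ (m : nat) y : R := K (mu + 1) (1 - y) * K (nu + 1 + m%:R) (1 + y).

Definition kT x y : R := p * K s (x - y) + (1 - p) * K s (y - x).

Definition eT (m : nat) x : \bar R := (\int[leb]_y (kT x y * wJ m y)%:E)%E.

(** The value of [eT 0]. Its product with [Calpha (2 - s) mu nu] is [pi / sin(pi s)], that is,
    Gamma(s) Gamma(1 - s). *)
Definition cT : R := - pi / (sin (pi * mu) + sin (pi * nu)).

Let p0 : 0 <= p. Proof. by case/andP: hp. Qed.
Let q0 : 0 <= 1 - p. Proof. by case/andP: hp => _; rewrite subr_ge0. Qed.
Let s0 : 0 < s. Proof. by case/andP: hs. Qed.
Let s1 : 0 < 1 - s. Proof. by case/andP: hs => _; rewrite subr_gt0. Qed.

Lemma wJ_ge0 m y : 0 <= wJ m y. Proof. by rewrite /wJ; nneg. Qed.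

Lemma kT_ge0 x y : 0 <= kT x y.
Proof. by rewrite /kT addr_ge0//; nneg. Qed.

Lemma measurable_wJ m : measurable_fun setT (wJ m).
Proof. by rewrite /wJ; measR. Qed.

Lemma measurable_kT2 x : measurable_fun setT (kT x).
Proof. by rewrite /kT; measR. Qed.

Lemma sin_pi_lt0 t : - s <= t -> t < 0 -> sin (pi * t) < 0.
Proof.
move=> st t0; have := pi_gt0 R => pi0.
rewrite -oppr_gt0 -sinN -mulrN; apply: sin_gt0_pi.
by rewrite mulr_gt0 ?oppr_gt0//= gtr_pMr//; slra.
Qed.

Lemma sin_mu_nu : sin (pi * mu) + sin (pi * nu) < 0.
Proof.
have [mu0|mu0] := ltP mu 0.
  have h : sin (pi * mu) < 0 by apply: sin_pi_lt0 => //; slra.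
  have [nu0|nu0] := ltP nu 0.
    by have h' : sin (pi * nu) < 0 by [apply: sin_pi_lt0 => //; slra]; slra.
  by rewrite (_ : nu = 0) ?mulr0 ?sin0 ?addr0//; slra.
rewrite (_ : mu = 0) ?mulr0 ?sin0 ?add0r; last by slra.
by apply: sin_pi_lt0; slra.
Qed.

Lemma cT_gt0 : 0 < cT.
Proof. by rewrite /cT mulNr oppr_gt0 pmulr_rlt0 ?invr_lt0 ?sin_mu_nu// pi_gt0. Qed.

(** With [qT], the condition [hsin] solved for the two weights: [p] and [1 - p] are the shares of
    [sin(pi nu)] and [sin(pi mu)] in their sum. *)
Lemma pT : p * (sin (pi * mu) + sin (pi * nu)) = sin (pi * nu).
Proof. by rewrite mulrDr hsin; ring. Qed.

Lemma qT : (1 - p) * (sin (pi * mu) + sin (pi * nu)) = sin (pi * mu).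
Proof. by rewrite mulrDr -hsin; ring. Qed.

Lemma Gamma_sin t : - s <= t -> t < 0 ->
  Gamma (- t) * Gamma (1 + t) = - pi / sin (pi * t).
Proof.
move=> st t0; have := @Gamma_reflection R (- t).
by rewrite opprK mulrN sinN invrN mulrN mulNr => -> //; slra.
Qed.

(** Reflection turns the Gamma product into [- pi / sin(pi mu)] and [qT] cancels the sine. The
    common value in [cT_mu] and [cT_nu] is what makes the left and right parts fit together. *)
Lemma cT_mu : mu < 0 -> (1 - p) * (Gamma (- mu) * Gamma (1 + mu)) = cT.
Proof.
move=> mu0; have h : sin (pi * mu) < 0 by apply: sin_pi_lt0 => //; slra.
have S0 := sin_mu_nu.
rewrite Gamma_sin//; last by slra.
apply: (mulIf (ltr0_neq0 S0)); rewrite /cT divfK ?ltr0_neq0//.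
rewrite mulrAC qT mulrCA divff ?mulr1// ltr0_neq0//.
Qed.

Lemma cT_nu : nu < 0 -> p * (Gamma (- nu) * Gamma (1 + nu)) = cT.
Proof.
move=> nu0; have h : sin (pi * nu) < 0 by apply: sin_pi_lt0 => //; slra.
have S0 := sin_mu_nu.
rewrite Gamma_sin//; last by slra.
apply: (mulIf (ltr0_neq0 S0)); rewrite /cT divfK ?ltr0_neq0//.
rewrite mulrAC pT mulrCA divff ?mulr1// ltr0_neq0//.
Qed.

Lemma p_mu0 : mu = 0 -> p = 1.
Proof.
move=> mu0; have S0 := sin_mu_nu; have := qT; rewrite mu0 mulr0 sin0 add0r.
move=> /eqP; rewrite mulf_eq0 => /orP[/eqP|/eqP]; first by slra.
by move: S0; rewrite mu0 mulr0 sin0 add0r => /[swap] ->; rewrite ltxx.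
Qed.

Lemma p_nu0 : nu = 0 -> p = 0.
Proof.
move=> nu0; have S0 := sin_mu_nu; have := pT; rewrite nu0 mulr0 sin0 addr0.
move=> /eqP; rewrite mulf_eq0 => /orP[/eqP//|/eqP].
by move: S0; rewrite nu0 mulr0 sin0 addr0 => /[swap] ->; rewrite ltxx.
Qed.

Lemma eT_split m x : (eT m x = p%:E * \int[leb]_y (K s (x - y) * wJ m y)%:E +
  (1 - p)%:E * \int[leb]_y (K s (y - x) * wJ m y)%:E)%E.
Proof.
rewrite -!ge0_integralZl_real//; first last.
- by move=> y; rewrite /wJ; nneg.
- by rewrite /wJ; measR.
- by move=> y; rewrite /wJ; nneg.
- by rewrite /wJ; measR.
rewrite -ge0_integralD//; first last.
- by apply/measurable_EFinP; rewrite /wJ; measR.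
- by move=> y _; rewrite lee_fin /wJ; nneg.
- by apply/measurable_EFinP; rewrite /wJ; measR.
- by move=> y _; rewrite lee_fin /wJ; nneg.
by apply: eq_integral => y _; rewrite -EFinD /kT; congr EFin; ring.
Qed.

(* [wJ 0] is, up to a constant, the fractional integral of order [1 - s] of [hJ]
   from the left and from the right, so its integrals of order [s] are
   primitives of [hJ]. *)
Definition hJ z : R := K (- mu) (1 + z) * K (- nu) (1 - z).

Lemma hJ_ge0 z : 0 <= hJ z. Proof. by rewrite /hJ; nneg. Qed.

Lemma measurable_hJ : measurable_fun setT hJ.
Proof. by rewrite /hJ; measR. Qed.

Lemma wJ0E y : wJ 0 y = K (mu + 1) (1 - y) * K (nu + 1) (1 + y).
Proof. by rewrite /wJ addr0. Qed.

(** [integral_K3] with orders [1 - s] and [- mu]; [mu + nu = - s] makes its third order equal to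
    [- nu]. *)
Lemma left_hJ y : mu < 0 -> y < 1 ->
  (\int[leb]_z (K (1 - s) (y - z) * hJ z)%:E =
   (2 `^ (s - 1) * Beta (1 - s) (- mu) * wJ 0 y)%:E)%E.
Proof.
move=> mu0 y1; have nmu0 : 0 < - mu by slra.
have := integral_K3 _ _ _ s1 nmu0 y1.
rewrite (_ : 1 - (1 - s) - - mu = - nu); last by slra.
rewrite (_ : - (1 - s) = s - 1); last by ring.
rewrite (_ : 1 - - mu = mu + 1); last by ring.
rewrite (_ : 1 - s - mu = nu + 1); last by slra.
by rewrite wJ0E.
Qed.

Lemma right_hJ y : nu < 0 -> -1 < y ->
  (\int[leb]_z (K (1 - s) (z - y) * hJ z)%:E =
   (2 `^ (s - 1) * Beta (1 - s) (- nu) * wJ 0 y)%:E)%E.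
Proof.
move=> nu0 y1; have nnu0 : 0 < - nu by slra.
have y1' : - y < 1 by slra.
rewrite -(ge0_integral_reflect (fun z => K (1 - s) (z - y) * hJ z) 0); first last.
- by move=> z; rewrite /hJ; nneg.
- by rewrite /hJ; measR.
have := integral_K3 _ _ _ s1 nnu0 y1'.
rewrite (_ : 1 - (1 - s) - - nu = - mu); last by slra.
rewrite (_ : - (1 - s) = s - 1); last by ring.
rewrite (_ : 1 - - nu = nu + 1); last by ring.
rewrite (_ : 1 - s - nu = mu + 1); last by slra.
rewrite opprK wJ0E [K (mu + 1) _ * _]mulrC => <-.
apply: eq_integral => z _; congr EFin; rewrite /hJ [K (- nu) _ * _]mulrC.
by congr (K _ _ * (K _ _ * K _ _)); ring.
Qed.

Lemma integral_hJ : mu < 0 -> nu < 0 ->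
  (\int[leb]_z (hJ z)%:E = (2 `^ (s - 1) * Beta (- mu) (- nu))%:E)%E.
Proof.
move=> mu0 nu0; have nmu0 : 0 < - mu by slra. have nnu0 : 0 < - nu by slra.
have := integral_KK _ _ 1 (-1) nnu0 nmu0.
rewrite opprK (_ : - nu - mu = s); last by slra.
rewrite K_gt0E; last by slra.
rewrite BetaC mulrC => <-; apply: eq_integral => z _; congr EFin.
by rewrite /hJ mulrC [z + 1]addrC.
Qed.

Lemma Beta_s : Beta s (1 - s) = Gamma s * Gamma (1 - s).
Proof. by rewrite /Beta subrKC (Gamma_nat 0) divr1. Qed.

Lemma left_wJ0 x : mu < 0 -> x < 1 ->
  ((2 `^ (s - 1) * Beta (1 - s) (- mu))%:E * \int[leb]_y (K s (x - y) * wJ 0 y)%:E =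
   (Beta s (1 - s))%:E * \int[leb]_z (K 1 (x - z) * hJ z)%:E)%E.
Proof.
move=> mu0 x1; have nmu0 : 0 < - mu by slra.
have := fracint_left_comp _ _ x _ s0 s1 measurable_hJ hJ_ge0.
rewrite subrKC => <-; rewrite -ge0_integralZl_real; first last.
- by move=> y; rewrite /wJ; nneg.
- by rewrite /wJ; measR.
- by rewrite mulr_ge0 ?powR_ge0// ltW// Beta_gt0.
apply: eq_integral => y _; have [xy|xy] := ltP 0 (x - y); last first.
  by rewrite K_le0// mul0r mulr0 mul0e.
by rewrite left_hJ//; [rewrite -EFinM; congr EFin; ring|slra].
Qed.

Lemma right_wJ0 x : nu < 0 -> -1 < x ->
  ((2 `^ (s - 1) * Beta (1 - s) (- nu))%:E * \int[leb]_y (K s (y - x) * wJ 0 y)%:E =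
   (Beta s (1 - s))%:E * \int[leb]_z (K 1 (z - x) * hJ z)%:E)%E.
Proof.
move=> nu0 x1; have nnu0 : 0 < - nu by slra.
have := fracint_right_comp _ _ x _ s0 s1 measurable_hJ hJ_ge0.
rewrite subrKC => <-; rewrite -ge0_integralZl_real; first last.
- by move=> y; rewrite /wJ; nneg.
- by rewrite /wJ; measR.
- by rewrite mulr_ge0 ?powR_ge0// ltW// Beta_gt0.
apply: eq_integral => y _; have [xy|xy] := ltP 0 (y - x); last first.
  by rewrite K_le0// mul0r mulr0 mul0e.
by rewrite right_hJ//; [rewrite -EFinM; congr EFin; ring|slra].
Qed.

(** The algebra of [eT0] with Gamma values as plain variables: [A], [B], [C], [D] stand for Gamma at
    [-mu], [-nu], [1 + mu], [1 + nu], [E] for Gamma(1 - s), [F] for the power of 2. *)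
Lemma Beta_ratio (r t A B C D E F : R) : A != 0 -> B != 0 -> C != 0 -> D != 0 ->
  E != 0 -> F != 0 -> r * (A * C) = t * (B * D) ->
  t / (F * (E * A / D)) = r / (F * (E * B / C)).
Proof.
move=> A0 B0 C0 D0 E0 F0 h.
transitivity (t * (B * D) / (F * E * A * B)).
  by field; rewrite ?A0 ?B0 ?C0 ?D0 ?E0 ?F0.
by rewrite -h; field; rewrite ?A0 ?B0 ?C0 ?D0 ?E0 ?F0.
Qed.

Lemma Beta_triple (t A B D E F H : R) : A != 0 -> D != 0 ->
  E != 0 -> F != 0 -> H != 0 ->
  t / (F * (E * A / D)) * (H * E) * (F * (A * B / H)) = t * (B * D).
Proof. by move=> A0 D0 E0 F0 H0; field; rewrite ?A0 ?D0 ?E0 ?F0 ?H0. Qed.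

Lemma eT0 x : -1 < x < 1 -> eT 0 x = cT%:E.
Proof.
move=> /andP[x0 x1]; rewrite eT_split.
(* At [mu = 0] the function [hJ] would contain the non-integrable kernel [K 0]; but then [p = 1] and
   [integral_KK] evaluates the left integral alone. *)
have [mu0|mu0] := ltP mu 0; last first.
  have {}mu0 : mu = 0 by slra.
  have nuE : nu = - s by slra.
  rewrite (p_mu0 mu0) subrr mul0e adde0 mul1e.
  have <- : Beta s (1 - s) = cT.
    rewrite Beta_s -cT_nu; last by slra.
    by rewrite (p_mu0 mu0) mul1r nuE opprK.
  transitivity (\int[leb]_y (K s (x - y) * K (1 - s) (y - -1))%:E)%E.
    apply: eq_integral => y _; congr EFin.
    have [xy|xy] := ltP 0 (x - y); last by rewrite K_le0// !mul0r.
    rewrite wJ0E mu0 add0r K1 ifT; last by slra.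
    by rewrite mul1r nuE opprK [y + 1]addrC [- s + 1]addrC.
  by rewrite integral_KK// subrKC K1 ifT ?mulr1//; slra.
have [nu0|nu0] := ltP nu 0; last first.
  have {}nu0 : nu = 0 by slra.
  have muE : mu = - s by slra.
  rewrite (p_nu0 nu0) subr0 mul0e add0e mul1e.
  have <- : Beta s (1 - s) = cT.
    by rewrite Beta_s -cT_mu// (p_nu0 nu0) subr0 mul1r muE opprK.
  transitivity (\int[leb]_y (K (1 - s) (1 - y) * K s (y - x))%:E)%E.
    apply: eq_integral => y _; congr EFin.
    have [xy|xy] := ltP 0 (y - x); last by rewrite (K_le0 s)// mul0r mulr0.
    rewrite wJ0E nu0 add0r K1 ifT; last by slra.
    by rewrite mulr1 muE [- s + 1]addrC mulrC.
  by rewrite integral_KK// subrK K1 ifT ?mulr1 1?BetaC//; slra.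
have nmu0 : 0 < - mu by slra. have nnu0 : 0 < - nu by slra.
have e1 : 1 - s - mu = 1 + nu by slra.
have e2 : 1 - s - nu = 1 + mu by slra.
have e3 : - mu - nu = s by slra.
have mu1 : 0 < 1 + mu by slra.
have nu1 : 0 < 1 + nu by slra.
have B1 : 0 < 2 `^ (s - 1) * Beta (1 - s) (- mu) by rewrite mulr_gt0 ?powR_gt0 ?Beta_gt0.
have B2 : 0 < 2 `^ (s - 1) * Beta (1 - s) (- nu) by rewrite mulr_gt0 ?powR_gt0 ?Beta_gt0.
(* By the balance condition the same factor [k] arises on both sides, so the primitives of [hJ] to
   the left and right of [x] add up to its full integral. *)
pose k := p / (2 `^ (s - 1) * Beta (1 - s) (- mu)).
have g1 : Gamma (- mu) != 0 := Gamma_neq0 _ nmu0.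
have g2 : Gamma (- nu) != 0 := Gamma_neq0 _ nnu0.
have g3 : Gamma (1 + mu) != 0 := Gamma_neq0 _ mu1.
have g4 : Gamma (1 + nu) != 0 := Gamma_neq0 _ nu1.
have g5 : Gamma (1 - s) != 0 := Gamma_neq0 _ s1.
have g7 : Gamma s != 0 := Gamma_neq0 _ s0.
have g6 : 2 `^ (s - 1) != 0 :> R by apply: lt0r_neq0; exact: powR_gt0.
have kE : k = (1 - p) / (2 `^ (s - 1) * Beta (1 - s) (- nu)).
  have h := etrans (cT_mu mu0) (esym (cT_nu nu0)).
  rewrite /k /Beta e1 e2.
  exact: Beta_ratio.
have -> : (p%:E * \int[leb]_y (K s (x - y) * wJ 0 y)%:E =
  (k * Beta s (1 - s))%:E * \int[leb]_z (K 1 (x - z) * hJ z)%:E)%E.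
  by rewrite EFinM -muleA -(left_wJ0 x mu0 x1) muleA -EFinM /k (divfK (lt0r_neq0 B1)).
have -> : ((1 - p)%:E * \int[leb]_y (K s (y - x) * wJ 0 y)%:E =
  (k * Beta s (1 - s))%:E * \int[leb]_z (K 1 (z - x) * hJ z)%:E)%E.
  by rewrite EFinM -muleA -(right_wJ0 x nu0 x0) muleA -EFinM kE (divfK (lt0r_neq0 B2)).
rewrite -ge0_muleDr; first last.
- by apply: integral_ge0 => z _; rewrite lee_fin /hJ; nneg.
- by apply: integral_ge0 => z _; rewrite lee_fin /hJ; nneg.
rewrite addeC -integral_offdiag; [|exact: measurable_hJ|exact: hJ_ge0].
rewrite integral_hJ// -EFinM; congr EFin.
rewrite -(cT_nu nu0) /k Beta_s /Beta e1 e3.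
exact: Beta_triple.
Qed.

End two_sided_moments.

(** * Moments of the weight against powers of [1 + y] *)

Section moment_recursion.
Local Open Scope ring_scope.
Context {R : realType}.
Local Notation leb := (@lebesgue_measure R).
Variables (p s mu nu : R).
Hypotheses (hp : 0 <= p <= 1) (hs : 0 < s < 1).
Hypotheses (hmu : - s <= mu <= 0) (hnu : - s <= nu <= 0) (hsum : mu + nu = - s).
Hypothesis hsin : p * sin (pi * mu) = (1 - p) * sin (pi * nu).
Implicit Types x y z t : R.

Ltac slra := move: (hp) (hs) (hmu) (hnu) (hsum) => ? ? ? ? ?; lra.

Local Notation wJ := (wJ mu nu).
Local Notation kT := (kT p s).
Local Notation eT := (eT p s mu nu).
Local Notation cT := (cT mu nu).

Let p0 : 0 <= p. Proof. by case/andP: hp. Qed.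
Let q0 : 0 <= 1 - p. Proof. by case/andP: hp => _; rewrite subr_ge0. Qed.
Let s0 : 0 < s. Proof. by case/andP: hs. Qed.

Lemma ge0_integralD_real (f g : R -> R) :
  measurable_fun setT f -> (forall y, 0 <= f y) ->
  measurable_fun setT g -> (forall y, 0 <= g y) ->
  (\int[leb]_y (f y + g y)%:E = \int[leb]_y (f y)%:E + \int[leb]_y (g y)%:E)%E.
Proof.
move=> mf f0 mg g0; under eq_integral do rewrite EFinD.
rewrite ge0_integralD//.
- by move=> y _; rewrite lee_fin.
- exact/measurable_EFinP.
- by move=> y _; rewrite lee_fin.
- exact/measurable_EFinP.
Qed.

(** [rr k] and [qq k] are the Pochhammer quotients [(1-s)_k / k!] and [(-mu)_k / k!]. *)
Definition rr (k : nat) : R := \prod_(i < k) ((i%:R + 1 - s) / (i%:R + 1)).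
Definition qq (k : nat) : R := \prod_(i < k) ((i%:R - mu) / (i%:R + 1)).

(* The two-sided integral sends [v ^+ m], [v = (1 + x) / 2], to
   [cT * \sum_(k <= m) rr k * qq (m - k) * v ^+ k]; here [wJ m] carries the
   power [(1 + y) ^+ m] instead. *)
Definition WT_coef (m k : nat) : R := cT * 2 ^+ (m - k) * rr k * qq (m - k).

Definition WT (m : nat) x : R := \sum_(k < m.+1) WT_coef m k * (1 + x) ^+ k.

Lemma rr_ge0 k : 0 <= rr k.
Proof.
apply: prodr_ge0 => i _; have i0 : 0 <= i%:R :> R := ler0n _ _.
by rewrite divr_ge0//; slra.
Qed.

Lemma qq_ge0 k : 0 <= qq k.
Proof.
apply: prodr_ge0 => i _; have i0 : 0 <= i%:R :> R := ler0n _ _.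
by rewrite divr_ge0//; slra.
Qed.

Lemma WT_coef_ge0 m k : 0 <= WT_coef m k.
Proof.
have c0 : 0 <= cT by apply: ltW; exact: (cT_gt0 p s).
rewrite /WT_coef; apply: mulr_ge0; last exact: qq_ge0.
apply: mulr_ge0; last exact: rr_ge0.
by apply: mulr_ge0 => //; exact: exprn_ge0.
Qed.

(** Since [rr] gains the factor [1 - s/(k+1)] from [k] to [k+1], [WT m.+1] is [(1 + x) WT m] minus
    [s] times the primitive of [WT m] from -1, plus a constant. *)
Lemma WTS m x : WT m.+1 x = (1 + x) * WT m x -
  s * \sum_(k < m.+1) WT_coef m k * ((k.+1%:R)^-1 * (1 + x) ^+ k.+1) +
  cT * 2 ^+ m.+1 * qq m.+1.
Proof.
rewrite /WT big_ord_recl /= addrC; congr (_ + _); last first.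
  by rewrite /WT_coef subn0 expr0 mulr1 /rr big_ord0 mulr1.
rewrite !big_distrr/= -sumrB; apply: eq_bigr => k _; rewrite /bump/= add1n.
rewrite /WT_coef subSS {1}/rr big_ord_recr/= -/(rr k) exprS.
have k0 : 0 <= k%:R :> R := ler0n _ _.
rewrite -[k.+1%:R]natr1; field; rewrite gt_eqF//; lra.
Qed.

Lemma wJS m y : wJ m.+1 y = (1 + y) * wJ m y.
Proof.
rewrite /wJ mulrCA KS; congr (_ * K _ _).
by rewrite -[m.+1%:R]natr1 addrA.
Qed.

Lemma K1_wJ m y : K 1 (1 + y) * wJ m y = wJ m y.
Proof.
rewrite K1; case: ifPn => [_|]; first by rewrite mul1r.
by rewrite -leNgt => y0; rewrite /wJ (K_le0 (nu + 1 + _))// !mulr0.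
Qed.

Definition eX m x : \bar R := (\int[leb]_y (p * K (s + 1) (x - y) * wJ m y)%:E)%E.
Definition eY m x : \bar R := (\int[leb]_y ((1 - p) * K (s + 1) (y - x) * wJ m y)%:E)%E.
Definition eZ m : \bar R := (\int[leb]_y (K (s + 1) (1 + y) * wJ m y)%:E)%E.

Lemma measurable_kTwJ m x : measurable_fun setT (fun y => kT x y * wJ m y).
Proof. by apply: measurable_funM; [exact: measurable_kT2|exact: measurable_wJ]. Qed.

Lemma kTwJ_ge0 m x y : 0 <= kT x y * wJ m y.
Proof. by apply: mulr_ge0; [exact: kT_ge0|exact: wJ_ge0]. Qed.

Lemma measurable_KwJ (f : R -> R) r a m : measurable_fun setT f ->
  measurable_fun setT (fun y => r * K a (f y) * wJ m y).
Proof.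
move=> mf; apply: measurable_funM; last exact: measurable_wJ.
by apply: measurable_funM => //; exact: measurable_K_comp.
Qed.

Lemma KwJ_ge0 r a u m y : 0 <= r -> 0 <= r * K a u * wJ m y.
Proof.
by move=> r0; apply: mulr_ge0; [apply: mulr_ge0 => //; exact: K_ge0|exact: wJ_ge0].
Qed.

Lemma measurable_subl x : measurable_fun setT (fun y => x - y).
Proof. by measR. Qed.

Lemma measurable_subr x : measurable_fun setT (fun y => y - x).
Proof. by measR. Qed.

Lemma eT_step m x : -1 < x -> (eT m.+1 x + eX m x = (1 + x)%:E * eT m x + eY m x)%E.
Proof.
move=> x1; have x0 : 0 <= 1 + x by lra.
have mX := measurable_KwJ _ p (s + 1) m (measurable_subl x).
have mY := measurable_KwJ _ (1 - p) (s + 1) m (measurable_subr x).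
rewrite /eT /eX /eY -(ge0_integralZl_real _ _ x0 (measurable_kTwJ m x) (kTwJ_ge0 m x)).
rewrite -(ge0_integralD_real _ _ (measurable_kTwJ m.+1 x) (kTwJ_ge0 m.+1 x) mX
  (fun y => KwJ_ge0 _ _ _ m y p0)).
rewrite -(ge0_integralD_real (fun y => (1 + x) * (kT x y * wJ m y)) _ _ _ mY
  (fun y => KwJ_ge0 _ _ _ m y q0)).
- by apply: eq_integral => y _; rewrite wJS -!KS /kT; congr EFin; ring.
- by apply: measurable_funM => //; exact: measurable_kTwJ.
- by move=> y; apply: mulr_ge0 => //; exact: kTwJ_ge0.
Qed.


Lemma wJ_supp m y : wJ m y != 0 -> -1 < y < 1.
Proof.
rewrite /wJ => h; apply/andP; split; rewrite ltNge; apply: contra h => y1.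
  by rewrite (K_le0 (nu + 1 + _)) ?mulr0//; lra.
by rewrite K_le0 ?mul0r//; lra.
Qed.

(** On the support of the weight [x - y <= 2], so the kernel of order [s + 1] is at most twice that
    of order [s]. *)
Lemma eX_fin m x : -1 < x < 1 -> (eT m x < +oo)%E -> (eX m x < +oo)%E.
Proof.
move=> x1 fT; have ler0n2 : 0 <= 2 :> R by [].
apply: (@le_lt_trans _ _ (2%:E * eT m x)%E); last first.
  by apply: lte_mul_pinfty.
rewrite /eT -(ge0_integralZl_real 2 _ ler0n2 (measurable_kTwJ m x) (kTwJ_ge0 m x)).
apply: ge0_le_integral; first exact: measurableT.
- by move=> y _; rewrite lee_fin; exact: KwJ_ge0.
- by apply/measurable_EFinP; exact: (measurable_KwJ _ p (s + 1) m (measurable_subl x)).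
- apply/measurable_EFinP; apply: measurable_funM; first exact: measurable_cst.
  exact: measurable_kTwJ.
move=> y _; rewrite lee_fin -KS.
have [->|w0] := eqVneq (wJ m y) 0; first by rewrite !mulr0.
have y1 := wJ_supp _ _ w0.
rewrite [leRHS]mulrA; apply: ler_wpM2r; first exact: wJ_ge0.
have h1 : 0 <= p * K s (x - y) by nneg.
have h2 : 0 <= (1 - p) * K s (y - x) by nneg.
have -> : p * ((x - y) * K s (x - y)) = (x - y) * (p * K s (x - y)) by ring.
have xy2 : x - y <= 2 by lra.
rewrite /kT; apply: (le_trans (ler_wpM2r _ xy2)) => //; lra.
Qed.

Lemma eY_fin m x : -1 < x < 1 -> (eT m x < +oo)%E -> (eY m x < +oo)%E.
Proof.
move=> x1 fT; have ler0n2 : 0 <= 2 :> R by [].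
apply: (@le_lt_trans _ _ (2%:E * eT m x)%E); last first.
  by apply: lte_mul_pinfty.
rewrite /eT -(ge0_integralZl_real 2 _ ler0n2 (measurable_kTwJ m x) (kTwJ_ge0 m x)).
apply: ge0_le_integral; first exact: measurableT.
- by move=> y _; rewrite lee_fin; exact: KwJ_ge0.
- by apply/measurable_EFinP; exact: (measurable_KwJ _ (1 - p) (s + 1) m (measurable_subr x)).
- apply/measurable_EFinP; apply: measurable_funM; first exact: measurable_cst.
  exact: measurable_kTwJ.
move=> y _; rewrite lee_fin -KS.
have [->|w0] := eqVneq (wJ m y) 0; first by rewrite !mulr0.
have y1 := wJ_supp _ _ w0.
rewrite [leRHS]mulrA; apply: ler_wpM2r; first exact: wJ_ge0.
have h1 : 0 <= p * K s (x - y) by nneg.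
have h2 : 0 <= (1 - p) * K s (y - x) by nneg.
have -> : (1 - p) * ((y - x) * K s (y - x)) = (y - x) * ((1 - p) * K s (y - x)) by ring.
have xy2 : y - x <= 2 by lra.
rewrite /kT; apply: (le_trans (ler_wpM2r _ xy2)) => //; lra.
Qed.

(** At the left end the powers of [1 + y] merge, as [s + nu = - mu], leaving a Beta integral over an
    interval of length 2. *)
Lemma eZE m : eZ m = (2 ^+ m.+1 * Beta (mu + 1) (m%:R + 1 - mu))%:E.
Proof.
have m0 : 0 <= m%:R :> R := ler0n _ _.
have a0 : 0 < mu + 1 by slra.
have b0 : 0 < m%:R + 1 - mu by slra.
have := integral_KK _ _ 1 (-1) a0 b0.
rewrite (_ : mu + 1 + (m%:R + 1 - mu) = m.+2%:R); last first.
  by rewrite -[m.+2%:R]natr1 -[m.+1%:R]natr1; ring.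
rewrite K_nat; last by lra.
rewrite opprK mulrC => <-; apply: eq_integral => y _; congr EFin.
rewrite /wJ mulrCA KM; congr (_ * K _ _); last by rewrite addrC.
by slra.
Qed.

(** Identifies the constant of integration: Gamma(m + 1 - mu) is [(m+1)! qq m.+1] times Gamma(-mu),
    which reduces the claim to [cT_mu]. At [mu = 0] both sides vanish. *)
Lemma qq_cT m : (1 - p) * Beta (mu + 1) (m%:R + 1 - mu) = cT * qq m.+1.
Proof.
have [mu0|mu0] := ltP mu 0; last first.
  have {}mu0 : mu = 0 by slra.
  rewrite (p_mu0 p s mu nu)// subrr mul0r.
  by rewrite /qq big_ord_recl/= mu0 subrr !mul0r mulr0.
have nmu0 : 0 < - mu by slra.
rewrite -(cT_mu p s mu nu)// -!mulrA; congr (_ * _).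
have GE n : Gamma (n%:R - mu) = n`!%:R * qq n * Gamma (- mu).
  elim: n => [|n IH]; first by rewrite /qq big_ord0 !mul1r add0r.
  have n0 : 0 <= n%:R :> R := ler0n _ _.
  have h : 0 < n%:R - mu by lra.
  rewrite -[n.+1%:R]natr1 addrAC (GammaS _ h) IH /qq big_ord_recr/= factS natrM.
  rewrite -[n.+1%:R]natr1; field; rewrite gt_eqF//; lra.
rewrite /Beta (_ : mu + 1 + (m%:R + 1 - mu) = m.+2%:R); last first.
  by rewrite -[m.+2%:R]natr1 -[m.+1%:R]natr1; ring.
rewrite Gamma_nat natr1 GE addrC.
have f0 : m.+1`!%:R != 0 :> R by rewrite pnatr_eq0 -lt0n fact_gt0.
move: (Gamma _) (Gamma _) f0 => A B; set F := _%:R => f0.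
by field.
Qed.

(** The primitive of the kernel in its first variable, from -1 to [x]. As [y > -1], the lower limit
    contributes only to the right-sided part. *)
Lemma integral_K1_kT x y : -1 < x -> -1 < y ->
  (\int[leb]_z (K 1 (x - z) * K 1 (1 + z) * kT z y)%:E =
   (s^-1 * (p * K (s + 1) (x - y) +
            (1 - p) * (K (s + 1) (1 + y) - K (s + 1) (y - x))))%:E)%E.
Proof.
move=> x1 y1.
have E1 : (\int[leb]_z (K 1 (x - z) * K s (z - y))%:E =
           (s^-1 * K (s + 1) (x - y))%:E)%E.
  by have := integral_KK 1 s x y ltr01 s0; rewrite (Beta1 _ s0) [1 + s]addrC.
have E2 : (\int[leb]_z (K 1 (1 + z) * K s (y - z))%:E =
           (s^-1 * K (s + 1) (1 + y))%:E)%E.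
  have := integral_KK s 1 y (-1) s0 ltr01; rewrite BetaC (Beta1 _ s0) opprK.
  rewrite [y + 1]addrC => <-.
  by apply: eq_integral => z _; rewrite mulrC [1 + z]addrC.
have E3 : (\int[leb]_z (K 1 (z - x) * (K 1 (1 + z) * K s (y - z)))%:E =
           (s^-1 * K (s + 1) (y - x))%:E)%E.
  have := integral_KK s 1 y x s0 ltr01; rewrite BetaC (Beta1 _ s0) => <-.
  apply: eq_integral => z _; congr EFin; rewrite [RHS]mulrC mulrA; congr (_ * _).
  rewrite !K1; case: ifPn => xz; last by rewrite mul0r.
  by rewrite ifT ?mul1r//; lra.
have E4 : (\int[leb]_z (K 1 (x - z) * (K 1 (1 + z) * K s (y - z)))%:E =
           (s^-1 * (K (s + 1) (1 + y) - K (s + 1) (y - x)))%:E)%E.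
  have mf : measurable_fun setT (fun z => K 1 (1 + z) * K s (y - z)) by measR.
  have f0 z : 0 <= K 1 (1 + z) * K s (y - z) by nneg.
  have := integral_offdiag _ x mf f0; rewrite E2 E3 mulrBr EFinB => ->.
  by rewrite addeAC subee// add0e.
transitivity (p%:E * \int[leb]_z (K 1 (x - z) * K s (z - y))%:E +
   (1 - p)%:E * \int[leb]_z (K 1 (x - z) * (K 1 (1 + z) * K s (y - z)))%:E)%E; last first.
  by rewrite E1 E4 -!EFinM -EFinD; congr EFin; ring.
rewrite -!ge0_integralZl_real//; first last.
- by move=> z; nneg.
- by measR.
- by move=> z; nneg.
- by measR.
rewrite -ge0_integralD//; first last.
- by apply/measurable_EFinP; measR.
- by move=> z _; rewrite lee_fin; nneg.
- by apply/measurable_EFinP; measR.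
- by move=> z _; rewrite lee_fin; nneg.
apply: eq_integral => z _; rewrite -EFinD /kT; congr EFin.
have [yz|yz] := ltP 0 (z - y); last by rewrite (K_le0 s (z - y))//; ring.
rewrite (K1 (1 + z)) ifT; last by lra.
by ring.
Qed.

Lemma integral_K1_WT m x : -1 < x ->
  (\int[leb]_z (K 1 (x - z) * K 1 (1 + z) * WT m z)%:E =
   (\sum_(k < m.+1) WT_coef m k * (k.+1%:R^-1 * (1 + x) ^+ k.+1))%:E)%E.
Proof.
move=> x1; have x0 : 0 < 1 + x by lra.
transitivity (\int[leb]_z \sum_(k < m.+1)
    (WT_coef m k * (K 1 (x - z) * K k.+1%:R (z - -1)))%:E)%E.
  apply: eq_integral => z _; rewrite sumEFin; congr EFin.
  rewrite /WT big_distrr/=; apply: eq_bigr => k _; rewrite opprK.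
  have [z1|z1] := ltP 0 (1 + z); last first.
    by rewrite (K_le0 _ (1 + z))// (K_le0 _ (z + 1)) 1?addrC// !(mul0r, mulr0).
  by rewrite (K1 (1 + z)) z1 K_nat 1?addrC// [z + 1]addrC; ring.
rewrite ge0_integral_sum//; first last.
- move=> k z _; rewrite lee_fin; apply: mulr_ge0; first exact: WT_coef_ge0.
  by nneg.
- by move=> k; apply/measurable_EFinP; measR.
rewrite -sumEFin; apply: eq_bigr => k _.
rewrite ge0_integralZl_real; first last.
- by move=> z; nneg.
- by measR.
- exact: WT_coef_ge0.
rewrite integral_KK// Beta1// -EFinM opprK [x + 1]addrC nat1r K_nat//.
Qed.

Lemma eT_integral m x : -1 < x < 1 ->
  (forall z, -1 < z < 1 -> eT m z = (WT m z)%:E) ->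
  (\int[leb]_y (K 1 (1 + y) * (s^-1 * (p * K (s + 1) (x - y) +
      (1 - p) * (K (s + 1) (1 + y) - K (s + 1) (y - x)))) * wJ m y)%:E =
   (\sum_(k < m.+1) WT_coef m k * (k.+1%:R^-1 * (1 + x) ^+ k.+1))%:E)%E.
Proof.
move=> /andP[x0 x1] IH.
rewrite -integral_K1_WT//.
rewrite -(integral_kernel_comp (fun z => K 1 (x - z) * K 1 (1 + z)) _ _
  (fun z y => K 1 (1 + y) * kT z y)); first last.
- move=> y; have [y1|y1] := ltP 0 (1 + y); last first.
    by rewrite integral0_eq ?(K_le0 1 (1 + y)) ?mul0r// => z _; rewrite mul0r mulr0.
  rewrite (K1 (1 + y)) y1 mul1r -integral_K1_kT//; last by lra.
  by apply: eq_integral => z _; rewrite mul1r.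
- by move=> z y; rewrite mulr_ge0 ?kT_ge0//; nneg.
- by rewrite /kT; measR.
- exact: wJ_ge0.
- exact: measurable_wJ.
- by move=> z; nneg.
- by measR.
apply: eq_integral => z _.
have [z1|z1] := ltP 0 (1 + z); last by rewrite (K_le0 1 (1 + z))// mulr0 mul0r mul0e.
have [xz|xz] := ltP 0 (x - z); last by rewrite (K_le0 1 (x - z))// !mul0r mul0e.
have zI : -1 < z < 1 by lra.
rewrite [RHS]EFinM -(IH _ zI); congr (_ * _)%E.
by apply: eq_integral => y _; rewrite -mulrA mulrCA K1_wJ.
Qed.

(** The integral of [eT m] from -1 to [x], computed once from [WT] and once by exchanging
    integrations. Together with [eT_step] it removes [eX] and [eY]. *)
Lemma eT_balance m x : -1 < x < 1 ->
  (forall z, -1 < z < 1 -> eT m z = (WT m z)%:E) ->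
  (s%:E * (\sum_(k < m.+1) WT_coef m k * (k.+1%:R^-1 * (1 + x) ^+ k.+1))%:E + eY m x =
   eX m x + (1 - p)%:E * eZ m)%E.
Proof.
move=> xI IH; have /andP[x0 x1] := xI; 
pose k3 y := K 1 (1 + y) * (s^-1 * (p * K (s + 1) (x - y) +
  (1 - p) * (K (s + 1) (1 + y) - K (s + 1) (y - x)))).
have <- : (\int[leb]_y (k3 y * wJ m y)%:E)%E = _ := eT_integral _ _ xI IH.
(* [k3] contains a difference; its sign is read off from its representation as an integral of a
   nonnegative kernel. *)
have k30 y : 0 <= k3 y.
  have [y1|y1] := ltP 0 (1 + y); last by rewrite /k3 K_le0// mul0r.
  rewrite /k3 mulr_ge0 ?K_ge0// -lee_fin -integral_K1_kT//; last by lra.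
  apply: integral_ge0 => z _; rewrite lee_fin.
  by rewrite !mulr_ge0 ?kT_ge0//; nneg.
have mk3 : measurable_fun setT k3 by rewrite /k3; measR.
have mk3w : measurable_fun setT (fun y => k3 y * wJ m y).
  by apply: measurable_funM => //; exact: measurable_wJ.
have mX := measurable_KwJ _ p (s + 1) m (measurable_subl x).
have mY := measurable_KwJ _ (1 - p) (s + 1) m (measurable_subr x).
have mZ : measurable_fun setT (fun y => K (s + 1) (1 + y) * wJ m y).
  by rewrite /wJ; measR.
have Z0 y : 0 <= K (s + 1) (1 + y) * wJ m y.
  by apply: mulr_ge0; [exact: K_ge0|exact: wJ_ge0].
have k3w0 y : 0 <= k3 y * wJ m y by apply: mulr_ge0 => //; exact: wJ_ge0.
rewrite /eX /eY /eZ -(ge0_integralZl_real _ _ q0 mZ Z0).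
rewrite -(ge0_integralZl_real _ _ (ltW s0) mk3w k3w0).
rewrite -(ge0_integralD_real (fun y => s * (k3 y * wJ m y)) _ _ _ mY
  (fun y => KwJ_ge0 _ _ _ m y q0)); first last.
- by move=> y; apply: mulr_ge0 => //; exact: ltW.
- exact: measurable_funM.
rewrite -(ge0_integralD_real _ (fun y => (1 - p) * (K (s + 1) (1 + y) * wJ m y)) mX
  (fun y => KwJ_ge0 _ _ _ m y p0)); first last.
- by move=> y; exact: mulr_ge0.
- exact: measurable_funM.
apply: eq_integral => y _; rewrite /k3; congr EFin.
rewrite mulrAC (mulrC (_ * wJ m y)) K1_wJ.
by field; rewrite gt_eqF.
Qed.

Lemma eTE m x : -1 < x < 1 -> eT m x = (WT m x)%:E.
Proof.
elim: m x => [|m IH] x xI.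
  rewrite eT0// /WT big_ord_recl big_ord0 /WT_coef /rr /qq !big_ord0.
  by rewrite !expr0 !mulr1 addr0.
have /andP[x0 x1] := xI.
have fT : (eT m x < +oo)%E by rewrite IH// ltry.
have ge0 (f : R -> R) : (forall y, 0 <= f y) -> (0 <= \int[leb]_y (f y)%:E)%E.
  by move=> f0; apply: integral_ge0 => y _; rewrite lee_fin.
have fX : eX m x \is a fin_num.
  by rewrite ge0_fin_numE ?eX_fin// ge0// => y; rewrite /wJ; nneg.
have fY : eY m x \is a fin_num.
  by rewrite ge0_fin_numE ?eY_fin// ge0// => y; rewrite /wJ; nneg.
have H1 := eT_step m x x0.
have H2 := eT_balance m x xI IH.
move: H1 H2; rewrite IH// eZE -(fineK fX) -(fineK fY) -!EFinM -!EFinD => H1 [H2].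
(* Subtraction is legitimate here because [eX] and [eY] are finite. *)
have : eT m.+1 x = ((1 + x) * WT m x + fine (eY m x) - fine (eX m x))%:E.
  by rewrite EFinB -H1 -addeA subee// adde0.
move=> ->; congr EFin; rewrite WTS.
have := qq_cT m; move: H2; set S := \sum_(k < _) _.
move: (Beta _ _) => B H2 E.
have -> : cT * 2 ^+ m.+1 * qq m.+1 = (1 - p) * (2 ^+ m.+1 * B).
  by rewrite mulrAC -E; ring.
by move: H2 => {H1 E fX fY fT IH ge0}; move: (fine _) (fine _) => X Y; lra.
Qed.

End moment_recursion.

(** * Jacobi polynomials, their equation, and its transport *)

Section jacobi_polynomials.
Local Open Scope ring_scope.
Context {R : realType}.
Implicit Types (a b s mu nu x z : R) (n m k j : nat).

Lemma gbinomS z j : gbinom z j.+1 * j.+1%:R = gbinom z j * (z - j%:R).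
Proof.
rewrite /gbinom big_ord_recr/= factS natrM.
have F0 : j`!%:R != 0 :> R by rewrite pnatr_eq0 -lt0n fact_gt0.
have N0 : j.+1%:R != 0 :> R by rewrite pnatr_eq0.
move: (\prod_(i < j) _) j`!%:R j.+1%:R F0 N0 => P F N F0 N0.
by field; rewrite ?F0 ?N0.
Qed.

Definition JPcoef a b n m : R := gbinom (n%:R + a) (n - m) * gbinom (n%:R + b) m.

(** The indeterminate is [v = (1 + x) / 2], so [(x - 1) / 2] becomes ['X - 1], and monomials match
    the powers of [1 + y] in [wJ]. *)
Definition JP a b n : {poly R} :=
  \sum_(m < n.+1) JPcoef a b n m *: (('X - 1) ^+ m * 'X^(n - m)).

Lemma jacobiPE a b n x : jacobiP a b n x = (JP a b n).[(1 + x) / 2].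
Proof.
rewrite /jacobiP /JP horner_sum; apply: eq_bigr => m _.
rewrite !hornerE /JPcoef mulrA; congr (_ * _ ^+ _ * _ ^+ _).
  by field.
by rewrite addrC.
Qed.

Lemma JPcoefS a b n m : (m <= n)%N ->
  JPcoef a b n.+1 m * (n.+1 - m)%:R = JPcoef (a + 1) (b + 1) n m * (m%:R + a + 1).
Proof.
move=> mn; rewrite /JPcoef subSn// mulrAC gbinomS mulrAC.
rewrite (_ : n.+1%:R + a = n%:R + (a + 1)); last by rewrite -[n.+1%:R]natr1; ring.
rewrite (_ : n.+1%:R + b = n%:R + (b + 1)); last by rewrite -[n.+1%:R]natr1; ring.
by rewrite natrB//; ring.
Qed.

Lemma JPcoefSS a b n m :
  JPcoef a b n.+1 m.+1 * m.+1%:R = JPcoef (a + 1) (b + 1) n m * (n%:R - m%:R + b + 1).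
Proof.
rewrite /JPcoef subSS -mulrA gbinomS mulrA.
rewrite (_ : n.+1%:R + a = n%:R + (a + 1)); last by rewrite -[n.+1%:R]natr1; ring.
rewrite (_ : n.+1%:R + b = n%:R + (b + 1)); last by rewrite -[n.+1%:R]natr1; ring.
by ring.
Qed.

Lemma deriv_monomial n m : (m <= n)%N ->
  (('X - 1 : {poly R}) ^+ m * 'X^(n - m))^`() =
  m%:R *: (('X - 1) ^+ m.-1 * 'X^(n - m)) +
  (n - m)%:R *: (('X - 1) ^+ m * 'X^((n - m).-1)).
Proof.
move=> mn; rewrite derivM derivXn deriv_exp derivB derivX derivC subr0 mul1r.
by rewrite !scaler_nat mulrnAl mulrnAr.
Qed.

(** The two terms of the product rule meet at the same monomial, with factors [n - m + b + 1] and
    [m + a + 1]. *)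
Lemma JP_deriv a b n :
  (JP a b n.+1)^`() = (n.+1%:R + a + b + 1) *: JP (a + 1) (b + 1) n.
Proof.
rewrite /JP (big_morph _ (@derivD R) (deriv0 R)).
under eq_bigr => m _ do rewrite derivZ deriv_monomial ?scalerDr ?scalerA -1?ltnS//.
rewrite big_split/= big_ord_recl/= mulr0 scale0r add0r.
rewrite [X in _ + X]big_ord_recr/= subnn mulr0 scale0r addr0.
rewrite -big_split scaler_sumr; apply: eq_bigr => m _ /=.
rewrite /bump/= add1n subSS JPcoefSS JPcoefS -1?ltnS//.
rewrite subSn -1?ltnS//= -scalerDl scalerA; congr (_ *: _).
by rewrite -[n.+1%:R]natr1; ring.
Qed.

(** The raising operator, from the same coefficient relations; composed with [JP_deriv] it factors
    the Jacobi equation. *)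
Lemma JP_raise a b n :
  ('X - 1) * 'X * (JP (a + 1) (b + 1) n)^`() +
  ((b + 1) *: ('X - 1) + (a + 1) *: 'X) * JP (a + 1) (b + 1) n =
  n.+1%:R *: JP a b n.+1.
Proof.
pose B m := JPcoef (a + 1) (b + 1) n m.
transitivity (\sum_(m < n.+1) ((B m * (m%:R + a + 1)) *: (('X - 1) ^+ m * 'X^(n.+1 - m)) +
   (B m * (n%:R - m%:R + b + 1)) *: (('X - 1) ^+ m.+1 * 'X^(n - m)))).
  rewrite /JP (big_morph _ (@derivD R) (deriv0 R)) !mulr_sumr -big_split/=; apply: eq_bigr => m _.
  have mn : (m <= n)%N by rewrite -ltnS.
  rewrite derivZ deriv_monomial// -/(B m) subSn// !exprS.
  case: m mn => m /= _ mn.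
  set u := 'X - 1; set Bm := B m.
  have E1 : m%:R *: (u * 'X * (u ^+ m.-1 * 'X^(n - m))) =
            m%:R *: (u ^+ m * ('X * 'X^(n - m))).
    case: m {Bm} mn => [|m] mn; first by rewrite !scale0r.
    by rewrite exprS /=; congr (_ *: _); ring.
  have E2 : (n - m)%:R *: (u * 'X * (u ^+ m * 'X^((n - m).-1))) =
            (n - m)%:R *: (u * u ^+ m * 'X^(n - m)).
    case: (n - m)%N => [|d]; first by rewrite !scale0r.
    by rewrite exprS /=; congr (_ *: _); ring.
  rewrite -scalerAr mulrDr -!scalerAr E1 E2 natrB//.
  by rewrite -!mul_polyC !(polyCD, polyCB, polyCM); ring.
rewrite big_split/=.
transitivity (
  \sum_(m < n.+2) ((JPcoef a b n.+1 m * (n.+1 - m)%:R) *: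
    (('X - 1) ^+ m * 'X^(n.+1 - m))) +
  \sum_(m < n.+2) ((JPcoef a b n.+1 m * m%:R) *:
    (('X - 1) ^+ m * 'X^(n.+1 - m)))).
  congr (_ + _).
    rewrite [RHS]big_ord_recr/= subnn mulr0 scale0r addr0.
    by apply: eq_bigr => m _; rewrite JPcoefS// -ltnS.
  rewrite [RHS]big_ord_recl/= mulr0 scale0r add0r.
  by apply: eq_bigr => m _; rewrite /bump/= add1n JPcoefSS subSS.
rewrite -big_split/= scaler_sumr; apply: eq_bigr => m _.
have mn : (m <= n.+1)%N by rewrite -ltnS.
by rewrite -scalerDl scalerA natrB//; congr (_ *: _); ring.
Qed.

Lemma JP_ode a b n :
  ('X - 1) * 'X * (JP a b n)^`()^`() +
  ((b + 1) *: ('X - 1) + (a + 1) *: 'X) * (JP a b n)^`() =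
  (n%:R * (n%:R + a + b + 1)) *: JP a b n.
Proof.
case: n => [|n].
  rewrite mul0r scale0r /JP big_ord_recl big_ord0 addr0 subnn !expr0 mulr1.
  by rewrite derivZ derivC scaler0 deriv0 !mulr0 addr0.
rewrite JP_deriv derivZ -!scalerAr -scalerDr JP_raise scalerA.
by rewrite mulrC.
Qed.

Lemma JP_rec a b n k :
  (k%:R * (k%:R + a + b + 1)) * (JP a b n)`_k -
  (k.+1%:R * (k.+1%:R + b)) * (JP a b n)`_k.+1 =
  (n%:R * (n%:R + a + b + 1)) * (JP a b n)`_k.
Proof.
have := congr1 (fun p : {poly R} => p`_k) (JP_ode a b n).
rewrite coefZ => <-; set P := JP a b n.
have -> : ('X - 1) * 'X * P^`()^`() + ((b + 1) *: ('X - 1) + (a + 1) *: 'X) * P^`() =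
  'X * ('X * P^`()^`()) - 'X * P^`()^`() +
  ((b + 1 + a + 1) *: ('X * P^`()) - (b + 1) *: P^`()).
  rewrite -!mul_polyC !polyCD; ring.
rewrite !(coefD, coefB, coefN, coefZ, coefXM, coef_deriv).
case: k => [|[|k]] /=; rewrite ?coefXM ?coef_deriv /=.
- by ring.
- by ring.
- by ring.
Qed.

Lemma size_JP a b n k : (n < k)%N -> (JP a b n)`_k = 0.
Proof.
move=> nk; rewrite /JP coef_sum big1// => m _; rewrite coefZ coefMXn.
have mn : (m <= n)%N by rewrite -ltnS.
case: ltnP => _; first by rewrite mulr0.
rewrite nth_default ?mulr0//.
rewrite (_ : 1 = 1%:P)// size_exp_XsubC.
by rewrite ltn_subRL subnK.
Qed.

Lemma lead_JP a b n : (JP a b n)`_n = \sum_(m < n.+1) JPcoef a b n m.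
Proof.
rewrite /JP coef_sum; apply: eq_bigr => m _; rewrite coefZ coefMXn.
have mn : (m <= n)%N by rewrite -ltnS.
rewrite ltnNge leq_subr/= subKn// -[RHS]mulr1; congr (_ * _).
have := monicP (monic_exp m (monicXsubC (1 : R))).
by rewrite /lead_coef size_exp_XsubC.
Qed.

Lemma lead_JP_sym a b n : (JP a b n)`_n = (JP b a n)`_n.
Proof.
rewrite !lead_JP (reindex_inj rev_ord_inj)/=; apply: eq_bigr => m _.
rewrite subSS /JPcoef mulrC subKn//; last by rewrite -ltnS.
Qed.

(** The guard is essential: for [k > m] truncated subtraction would give [qq mu 0 = 1]. *)
Definition gq mu k m : R := if (k <= m)%N then qq mu (m - k) else 0.

Lemma qqS mu j : qq mu j.+1 * j.+1%:R = qq mu j * (j%:R - mu).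
Proof.
by rewrite /qq big_ord_recr/= -[j.+1%:R]natr1 -mulrA divfK.
Qed.

Lemma rrS s j : rr s j.+1 * j.+1%:R = rr s j * (j%:R + 1 - s).
Proof.
by rewrite /rr big_ord_recr/= -[j.+1%:R]natr1 -mulrA divfK.
Qed.

(* Coefficients of the image of [JP mu nu n]. The recursions of [JP] and [TJ]
   are the hypergeometric equation; an eigenvector of it of degree less than
   [n] with the eigenvalue of degree [n] vanishes. *)
Definition TJ s mu nu n k : R :=
  rr s k * \sum_(m < n.+1) (JP mu nu n)`_m * gq mu k m.

(** The intertwining on [v^m], with the factor [rr] divided out: on the left the operator of
    [(nu, mu)] acts on the image, on the right that of [(mu, nu)] on the monomial. *)
Lemma gq_rec s mu nu k m : mu + nu = - s ->
  k%:R * (k%:R + 1 - s) * gq mu k m - (k.+1%:R + mu) * (k%:R + 1 - s) * gq mu k.+1 m =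
  m%:R * (m%:R + 1 - s) * gq mu k m - m%:R * (m%:R + nu) * gq mu k.+1 m.
Proof.
move=> hsum; rewrite /gq; have [km|km|<-] := ltngtP k m.
- have -> : (m - k = (m - k.+1).+1)%N by rewrite subnSK.
  have := qqS mu (m - k.+1).
  have : m%:R = k%:R + 1 + (m - k.+1)%:R :> R.
    by rewrite natr1 -natrD subnKC.
  move: (m - k.+1)%N => j mE.
  rewrite -[j.+1%:R]natr1 -[k.+1%:R]natr1 mE.
  move: (qq mu j.+1) (qq mu j) => A B H.
  have nuE : nu = - s - mu by lra.
  rewrite nuE.
  apply/eqP; rewrite -subr_eq0; apply/eqP.
  (* With [m = k + 1 + j] and [nu] eliminated, the two sides differ by a multiple of the relation
     [qqS]. *)
  transitivity (- (2 * k%:R + j%:R + 2 - s) * (A * (j%:R + 1) - B * (j%:R - mu))).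
    by ring.
  by rewrite H subrr mulr0.
- by rewrite !mulr0.
- by rewrite !mulr0.
Qed.

Lemma TJ_rec s mu nu n k : mu + nu = - s ->
  k%:R * (k%:R + 1 - s) * TJ s mu nu n k - k.+1%:R * (k.+1%:R + mu) * TJ s mu nu n k.+1 =
  n%:R * (n%:R + 1 - s) * TJ s mu nu n k.
Proof.
move=> hsum; pose f m := (JP mu nu n)`_m.
have ab (c : R) : c + mu + nu + 1 = c + 1 - s by lra.
have fE m : m%:R * (m%:R + 1 - s) * f m - m.+1%:R * (m.+1%:R + nu) * f m.+1 =
   n%:R * (n%:R + 1 - s) * f m.
  by have := JP_rec mu nu n m; rewrite !ab.
(* [gq] depends only on [m - k], so both indices move together; the boundary terms vanish by the
   factor [m] and by the degree of [JP]. *)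
have shift : \sum_(m < n.+1) m.+1%:R * (m.+1%:R + nu) * f m.+1 * gq mu k m =
    \sum_(m < n.+1) m%:R * (m%:R + nu) * f m * gq mu k.+1 m.
  transitivity (\sum_(m < n.+2) m%:R * (m%:R + nu) * f m * gq mu k.+1 m).
    by rewrite [RHS]big_ord_recl/= !mul0r add0r.
  by rewrite big_ord_recr/= /f size_JP// mulr0 mul0r addr0.
have -> : k.+1%:R * (k.+1%:R + mu) * TJ s mu nu n k.+1 =
   rr s k * ((k.+1%:R + mu) * (k%:R + 1 - s) * \sum_(m < n.+1) f m * gq mu k.+1 m).
  have := rrS s k; rewrite /TJ; move: (\sum_(m < _) _) => S H.
  transitivity ((k.+1%:R + mu) * (rr s k.+1 * k.+1%:R) * S); first by ring.
  by rewrite H; ring.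
rewrite /TJ -/f.
rewrite ![_ * (rr s k * _)]mulrCA -mulrBr; congr (_ * _).
rewrite !mulr_sumr -sumrB.
transitivity (\sum_(m < n.+1) m%:R * (m%:R + 1 - s) * f m * gq mu k m -
   \sum_(m < n.+1) m%:R * (m%:R + nu) * f m * gq mu k.+1 m).
  rewrite -sumrB; apply: eq_bigr => m _.
  have := gq_rec s mu nu k m hsum; rewrite -/(f m); move: (f m) => c H.
  transitivity (c * (k%:R * (k%:R + 1 - s) * gq mu k m -
     (k.+1%:R + mu) * (k%:R + 1 - s) * gq mu k.+1 m)); first by ring.
  by rewrite H; ring.
rewrite -shift -sumrB; apply: eq_bigr => m _.
by rewrite -mulrBl fE mulrA.
Qed.

Lemma TJE s mu nu n k : 0 < s < 1 -> mu + nu = - s ->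
  TJ s mu nu n k = rr s n * (JP nu mu n)`_k.
Proof.
move=> hs hsum; pose e k := TJ s mu nu n k - rr s n * (JP nu mu n)`_k.
suff : e k = 0 by move/eqP; rewrite subr_eq0 => /eqP.
have e_rec j : (j%:R * (j%:R + 1 - s) - n%:R * (n%:R + 1 - s)) * e j =
    j.+1%:R * (j.+1%:R + mu) * e j.+1.
  have H1 := TJ_rec s mu nu n j hsum.
  have H2 := JP_rec nu mu n j.
  have ab (c : R) : c + nu + mu + 1 = c + 1 - s by lra.
  rewrite !ab in H2.
  rewrite /e; move: H1 H2; move: (TJ s mu nu n j) (TJ s mu nu n j.+1) => T1 T2.
  move: ((JP nu mu n)`_j) ((JP nu mu n)`_j.+1) (rr s n) => P1 P2 r H1 H2.
  transitivity (j%:R * (j%:R + 1 - s) * T1 - n%:R * (n%:R + 1 - s) * T1 -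
     r * (j%:R * (j%:R + 1 - s) * P1 - n%:R * (n%:R + 1 - s) * P1)); first by ring.
  by rewrite -H1 -H2; ring.
have [kn|kn] := leqP k n; last first.
  rewrite /e size_JP// mulr0 subr0 /TJ big1 ?mulr0// => m _.
  by rewrite /gq leqNgt (leq_trans (ltn_ord m))// mulr0.
(* Descending from the top coefficient, where [lead_JP_sym] gives equality; below it the eigenvalues
   of [j < n] and [n] differ, so [e_rec] propagates zero. *)
rewrite -(subKn kn); elim: (n - k)%N (leq_subr k n) => [|d IH] dn.
  rewrite subn0 /e /TJ big_ord_recr/= big1 ?add0r; last first.
    by move=> m _; rewrite /gq leqNgt ltn_ord mulr0.
  by rewrite /gq leqnn subnn /qq big_ord0 mulr1 lead_JP_sym subrr.
have := e_rec (n - d.+1)%N; rewrite subnSK// IH ?(ltnW dn)// mulr0 => /eqP.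
rewrite mulf_eq0 => /orP[|/eqP//]; rewrite lt_eqF//.
have jn : (n - d.+1)%:R + 1 <= n%:R :> R by rewrite natr1 ler_nat subnSK// leq_subr.
have j0 : 0 <= (n - d.+1)%:R :> R := ler0n _ _.
move: jn j0; move: (n - d.+1)%:R => j jn j0; nra.
Qed.

End jacobi_polynomials.

(** * Differentiating Jacobi polynomials in [x] *)

Section jacobi_derivative.
Local Open Scope ring_scope.
Context {R : realType}.
Implicit Types (a b x : R).

Lemma jacobiP_horner a b n :
  jacobiP a b n = horner (JP a b n \Po (2^-1 *: ('X + 1))).
Proof.
apply/funext => x; rewrite jacobiPE horner_comp !hornerE; congr (_.[_]).
by rewrite addrC mulrC.
Qed.

Lemma is_derive_jacobiP a b n x :
  is_derive x 1 (jacobiP a b n.+1)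
    ((n.+1%:R + a + b + 1) / 2 * jacobiP (a + 1) (b + 1) n x).
Proof.
rewrite !jacobiP_horner; apply: is_derive_eq.
rewrite deriv_comp JP_deriv derivZ derivD derivX derivC addr0 comp_polyZ.
by rewrite hornerM !hornerZ hornerC mulr1 mulrAC.
Qed.

End jacobi_derivative.

(** * The two-sided integral of a poly-fractonomial *)

Section two_sided_jacobi.
Local Open Scope ring_scope.
Context {R : realType}.
Local Notation leb := (@lebesgue_measure R).

Lemma integrable_sum_real N (c : 'I_N -> R) (g : 'I_N -> R -> R) :
  (forall m, leb.-integrable setT (EFin \o g m)) ->
  leb.-integrable setT (EFin \o (fun y => \sum_(m < N) c m * g m y)) /\
  Rintegral leb setT (fun y => \sum_(m < N) c m * g m y) =
  \sum_(m < N) c m * Rintegral leb setT (g m).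
Proof.
elim: N c g => [|N IH] c g gi.
  split.
    rewrite (_ : EFin \o _ = cst 0%E); first exact: integrable0.
    by apply/funext => y /=; rewrite big_ord0.
  rewrite big_ord0 -[RHS](mul0r (fine (leb setT))) -Rintegral_cst//.
  by apply: eq_Rintegral => y _; rewrite big_ord0.
have [i1 e1] := IH (fun m => c (widen_ord (leqnSn N) m))
  (fun m => g (widen_ord (leqnSn N) m)) (fun m => gi _).
have i2 : leb.-integrable setT (EFin \o (fun y => c ord_max * g ord_max y)).
  rewrite (_ : EFin \o _ = (fun y => (c ord_max)%:E * (EFin \o g ord_max) y)%E); last first.
    by apply/funext => y /=; rewrite EFinM.
  exact: integrableZl.
move: i1 e1; set h := fun y => \sum_(m < N) _ => i1 e1.
have E : (fun y => \sum_(m < N.+1) c m * g m y) =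
   (fun y => h y + c ord_max * g ord_max y) by apply/funext => y; rewrite big_ord_recr.
rewrite E; split.
  rewrite (_ : EFin \o _ = ((EFin \o h) \+
     (EFin \o (fun y => (c ord_max * g ord_max y)%R)))%E); last first.
    by apply/funext => y /=; rewrite EFinD.
  exact: integrableD.
by rewrite RintegralD// e1 big_ord_recr/= RintegralZl.
Qed.

Variables (p s mu nu : R).
Hypotheses (hp : 0 <= p <= 1) (hs : 0 < s < 1).
Hypotheses (hmu : - s <= mu <= 0) (hnu : - s <= nu <= 0) (hsum : mu + nu = - s).
Hypothesis hsin : p * sin (pi * mu) = (1 - p) * sin (pi * nu).

(** The finite moments [eTE] provide the dominating function that linearity with signed coefficients
    requires. *)
Lemma integrable_eT m x (g : R -> R) : -1 < x < 1 -> measurable_fun setT g ->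
  (forall y, 0 <= g y <= kT p s x y * wJ mu nu m y) ->
  leb.-integrable setT (EFin \o g).
Proof.
move=> xI mg gk; apply/integrableP; split; first exact/measurable_EFinP.
apply: (@le_lt_trans _ _ (eT p s mu nu m x)); last first.
  by rewrite (eTE p s mu nu)// ltry.
apply: ge0_le_integral; first exact: measurableT.
- by move=> y _; exact: abse_ge0.
- by apply: measurableT_comp => //; exact/measurable_EFinP.
- by apply/measurable_EFinP; exact: measurable_kTwJ.
- move=> y _; have /andP[g0 gle] := gk y.
  by rewrite /= ger0_norm// lee_fin.
Qed.

(** The factor [p] stays inside because [eT] dominates only [p] times the left kernel. *)
Definition gL m x y : R := p * K s (x - y) * wJ mu nu m y.
Definition gR m x y : R := (1 - p) * K s (y - x) * wJ mu nu m y.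

Let p0 : 0 <= p. Proof. by case/andP: hp. Qed.
Let q0 : 0 <= 1 - p. Proof. by case/andP: hp => _; rewrite subr_ge0. Qed.

Lemma integrable_gL m x : -1 < x < 1 -> leb.-integrable setT (EFin \o gL m x).
Proof.
move=> xI; apply: (integrable_eT m x) => //.
  exact: (measurable_KwJ mu nu _ p s m (measurable_subl x)).
move=> y; rewrite KwJ_ge0//= /kT mulrDl lerDl.
exact: KwJ_ge0.
Qed.

Lemma integrable_gR m x : -1 < x < 1 -> leb.-integrable setT (EFin \o gR m x).
Proof.
move=> xI; apply: (integrable_eT m x) => //.
  exact: (measurable_KwJ mu nu _ (1 - p) s m (measurable_subr x)).
move=> y; rewrite KwJ_ge0//= /kT mulrDl lerDr.
exact: KwJ_ge0.
Qed.

Lemma Rintegral_gLR m x : -1 < x < 1 ->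
  Rintegral leb setT (gL m x) + Rintegral leb setT (gR m x) = WT s mu nu m x.
Proof.
move=> xI; rewrite -RintegralD//; [|exact: integrable_gL|exact: integrable_gR].
transitivity (fine (eT p s mu nu m x)); last by rewrite (eTE p s mu nu).
by congr fine; apply: eq_integral => y _; congr EFin; rewrite /gL /gR /kT; ring.
Qed.


Lemma wJE m y : -1 < y < 1 ->
  wJ mu nu m y = (1 - y) `^ mu * (1 + y) `^ nu * (1 + y) ^+ m.
Proof.
move=> yI; elim: m => [|m IH]; last by rewrite wJS IH exprS; ring.
rewrite /wJ !K_gt0E; [|by lra|by lra].
by rewrite addr0 !addrK mulr1.
Qed.

Lemma jacobi_wJ n y : -1 < y < 1 ->
  polyfrac mu nu n y = \sum_(m < n.+1) ((JP mu nu n)`_m / 2 ^+ m) * wJ mu nu m y.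
Proof.
move=> yI; rewrite /polyfrac jacobiPE (horner_coef_wide (n := n.+1)); last first.
  by apply/leq_sizeP => j nj; exact: size_JP.
rewrite mulr_sumr; apply: eq_bigr => m _; rewrite wJE// expr_div_n.
by ring.
Qed.

Lemma Rintegral_left n x : -1 < x < 1 ->
  p * Rintegral leb `]-1, x[ (fun y => (x - y) `^ (s - 1) * polyfrac mu nu n y) =
  \sum_(m < n.+1) ((JP mu nu n)`_m / 2 ^+ m) * Rintegral leb setT (gL m x).
Proof.
(* At [p = 0] both sides vanish and the left integral itself is never evaluated; otherwise [p] can
   be divided out. *)
move=> xI; have [p1|p1] := eqVneq p 0.
  rewrite p1 mul0r big1// => m _.
  rewrite (_ : gL m x = cst 0); last by apply/funext => y; rewrite /gL p1 !mul0r.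
  by rewrite Rintegral_cst// mul0r mulr0.
have [iS <-] := integrable_sum_real n.+1
  (fun m => (JP mu nu n)`_m / 2 ^+ m) _ (fun m : 'I_n.+1 => integrable_gL m x xI).
move: iS; set S := (fun y => \sum_(m < n.+1) _) => iS.
suff -> : Rintegral leb `]-1, x[ (fun y => (x - y) `^ (s - 1) * polyfrac mu nu n y) =
    Rintegral leb setT (fun y => p^-1 * S y).
  by rewrite RintegralZl// mulrA divff// mul1r.
rewrite Rintegral_mkcond; apply: eq_Rintegral => y _; rewrite patchE.
have [/andP[y1 yx]|yI] := boolP (-1 < y < x).
  rewrite mem_set/= ?in_itv/= ?y1 ?yx// jacobi_wJ; last by lra.
  rewrite /S !mulr_sumr; apply: eq_bigr => m _.
  by rewrite /gL K_gt0E ?subr_gt0//; field; rewrite ?p1 ?expf_neq0.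
rewrite memNset/= ?in_itv/=; last exact/negP.
rewrite /S big1 ?mulr0// => m _; rewrite /gL.
move: yI; rewrite negb_and -!leNgt => /orP[y1|y1]; last first.
  by rewrite K_le0 ?subr_le0// !(mulr0, mul0r).
by rewrite /wJ (K_le0 (nu + 1 + _)) ?mulr0//; lra.
Qed.

Lemma Rintegral_right n x : -1 < x < 1 ->
  (1 - p) * Rintegral leb `]x, 1[ (fun y => (y - x) `^ (s - 1) * polyfrac mu nu n y) =
  \sum_(m < n.+1) ((JP mu nu n)`_m / 2 ^+ m) * Rintegral leb setT (gR m x).
Proof.
move=> xI; have [p1|p1] := eqVneq (1 - p) 0.
  rewrite p1 mul0r big1// => m _.
  rewrite (_ : gR m x = cst 0); last by apply/funext => y; rewrite /gR p1 !mul0r.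
  by rewrite Rintegral_cst// mul0r mulr0.
have [iS <-] := integrable_sum_real n.+1
  (fun m => (JP mu nu n)`_m / 2 ^+ m) _ (fun m : 'I_n.+1 => integrable_gR m x xI).
move: iS; set S := (fun y => \sum_(m < n.+1) _) => iS.
suff -> : Rintegral leb `]x, 1[ (fun y => (y - x) `^ (s - 1) * polyfrac mu nu n y) =
    Rintegral leb setT (fun y => (1 - p)^-1 * S y).
  by rewrite RintegralZl// mulrA divff// mul1r.
rewrite Rintegral_mkcond; apply: eq_Rintegral => y _; rewrite patchE.
have [/andP[y1 yx]|yI] := boolP (x < y < 1).
  rewrite mem_set/= ?in_itv/= ?y1 ?yx// jacobi_wJ; last by lra.
  rewrite /S !mulr_sumr; apply: eq_bigr => m _.
  move: p1; rewrite /gR; move: (1 - p) => q q1.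
  by rewrite K_gt0E ?subr_gt0//; field; rewrite ?q1 ?expf_neq0.
rewrite memNset/= ?in_itv/=; last exact/negP.
rewrite /S big1 ?mulr0// => m _; rewrite /gR.
move: yI; rewrite negb_and -!leNgt => /orP[y1|y1].
  by rewrite K_le0 ?subr_le0// !(mulr0, mul0r).
by rewrite /wJ (K_le0 (mu + 1)) ?mul0r ?mulr0//; lra.
Qed.

(** Dividing [WT m] by [2^m] gives a polynomial in [v]; exchanging the sums produces the
    coefficients [TJ], which [TJE] identifies. *)
Lemma sum_WT n x : \sum_(m < n.+1) ((JP mu nu n)`_m / 2 ^+ m) * WT s mu nu m x =
  cT mu nu * rr s n * jacobiP nu mu n x.
Proof.
pose v := (1 + x) / 2.
have WTE m : (m < n.+1)%N -> WT s mu nu m x / 2 ^+ m =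
    cT mu nu * \sum_(k < n.+1) rr s k * gq mu k m * v ^+ k.
  move=> mn; rewrite /WT mulr_suml mulr_sumr.
  rewrite [RHS](bigID (fun k : 'I_n.+1 => (k < m.+1)%N))/= [X in _ = _ + X]big1 ?addr0; last first.
    by move=> k; rewrite ltnS => km; rewrite /gq (negbTE km) mulr0 mul0r mulr0.
  rewrite (big_ord_widen n.+1 (fun k => WT_coef s mu nu m k * (1 + x) ^+ k / 2 ^+ m))//.
  apply: eq_bigr => k; rewrite ltnS => km; rewrite /gq km /WT_coef /v expr_div_n.
  rewrite -[in X in _ / X](subnK km) exprD.
  by field; rewrite !expf_neq0.
transitivity (\sum_(m < n.+1) (JP mu nu n)`_m *
    (cT mu nu * \sum_(k < n.+1) rr s k * gq mu k m * v ^+ k)).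
  by apply: eq_bigr => m _; rewrite -WTE// -mulrA; congr (_ * _); rewrite mulrC.
rewrite jacobiPE -/v (horner_coef_wide (n := n.+1)); last first.
  by apply/leq_sizeP => j nj; exact: size_JP.
rewrite -mulrA mulr_sumr.
transitivity (cT mu nu * \sum_(k < n.+1) TJ s mu nu n k * v ^+ k); last first.
  by congr (_ * _); apply: eq_bigr => k _; rewrite TJE// mulrA.
under eq_bigr do rewrite mulrCA mulr_sumr.
rewrite -mulr_sumr exchange_big/=; congr (_ * _); apply: eq_bigr => k _.
by rewrite /TJ mulr_sumr mulr_suml; apply: eq_bigr => m _; ring.
Qed.

Lemma Gamma_rr n : Gamma (n%:R + (1 - s)) = n`!%:R * rr s n * Gamma (1 - s).
Proof.
elim: n => [|n IH]; first by rewrite /rr big_ord0 !mul1r add0r.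
have h : 0 < n%:R + (1 - s).
  by have n0 : 0 <= n%:R :> R := ler0n _ _; move: (hs) => ?; lra.
rewrite -[n.+1%:R]natr1 addrAC (GammaS _ h) IH factS natrM.
transitivity (n`!%:R * (rr s n * (n%:R + 1 - s)) * Gamma (1 - s)); first by ring.
by rewrite -rrS; ring.
Qed.

Lemma twoSidedInt_jacobi n x : -1 < x < 1 ->
  twoSidedInt (2 - s) p mu nu s (polyfrac mu nu n) x =
  Gamma (n%:R + (1 - s)) / Gamma (n%:R + 1) * jacobiP nu mu n x.
Proof.
move=> xI; rewrite /twoSidedInt /leftRLint /rightRLint.
set RL := Rintegral _ _ _; set RR := Rintegral _ _ _.
have E : p * RL + (1 - p) * RR = cT mu nu * rr s n * jacobiP nu mu n x.
  rewrite /RL /RR Rintegral_left// Rintegral_right// -big_split/= -sum_WT.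
  by apply: eq_bigr => m _; rewrite -mulrDr Rintegral_gLR.
have S0 := sin_mu_nu p s mu nu hp hs hmu hnu hsum.
(* [sin(pi (2 - s)) = - sin(pi s)]; the sign cancels the one in [cT]. *)
have -> : Calpha (2 - s) mu nu = - (sin (pi * mu) + sin (pi * nu)) / sin (pi * s).
  rewrite /Calpha (_ : pi * (2 - s) = - (pi * s) + pi *+ 2); last by rewrite mulr2n; ring.
  by rewrite sinD2pi sinN invrN mulrN mulNr.
have s0 : 0 < s by case/andP: hs.
rewrite Gamma_rr natr1 Gamma_nat.
transitivity (- (sin (pi * mu) + sin (pi * nu)) / sin (pi * s) *
  ((Gamma s)^-1 * (p * RL + (1 - p) * RR))); first by ring.
rewrite E /cT.
have sn0 : sin (pi * s) != 0.
  apply: lt0r_neq0; apply: sin_gt0_pi; have pi0 := pi_gt0 R.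
  by rewrite mulr_gt0//= gtr_pMr//; case/andP: hs.
have f0 : n`!%:R != 0 :> R by rewrite pnatr_eq0 -lt0n fact_gt0.
have := Gamma_reflection _ hs; have := Gamma_neq0 _ s0.
move: (Gamma s) (Gamma (1 - s)) => G G1 G0 GE.
have -> : G1 = pi / sin (pi * s) / G by rewrite -GE mulrAC divff// mul1r.
move: (ltr0_neq0 S0) f0 sn0.
move: (sin (pi * mu) + sin (pi * nu)) n`!%:R (sin (pi * s)) => S F si Sn0 F0 si0.
by field; rewrite ?Sn0 ?F0 ?si0 ?G0.
Qed.

End two_sided_jacobi.

(** Differentiation brings out [(n - j) + nu + j + mu + j + 1 = n + j + alpha - 1], the factor by
    which Gamma advances, and [1/2]. *)
Lemma is_derive_jacobi_tower {R : realType} (alpha mu nu x : R) (n j : nat) :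
  1 < alpha -> mu + nu = alpha - 2 ->
  let h (i : nat) (t : R) := Gamma (n%:R + i%:R + alpha - 1) / (2 ^+ i * Gamma (n%:R + 1)) *
    (if (i <= n)%N then jacobiP (nu + i%:R) (mu + i%:R) (n - i) t else 0) in
  is_derive x 1 (h j) (h j.+1 x).
Proof.
move=> a1 hsum h.
have n0 : 0 <= n%:R :> R := ler0n _ _.
have j0 : 0 <= j%:R :> R := ler0n _ _.
(* From [j = n] on, [h j] is constant (degree 0) or zero, and the guard makes [h j.+1] vanish. *)
have [jn|jn] := ltnP j n; last first.
  have -> : h j.+1 x = 0 by rewrite /h ltnNge jn/= mulr0.
  suff -> : h j = cst (h j 0) by exact: is_derive_cst.
  apply/funext => t; rewrite /h /=; case: ifPn => // jn'.
  have -> : (n - j = 0)%N by apply/eqP; rewrite subn_eq0.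
  by rewrite /jacobiP !big_ord_recl !big_ord0 !expr0.
have g0 : 0 < n%:R + j%:R + alpha - 1 by lra.
have GE : Gamma (n%:R + j.+1%:R + alpha - 1) =
    (n%:R + j%:R + alpha - 1) * Gamma (n%:R + j%:R + alpha - 1).
  by rewrite -(GammaS _ g0) -[j.+1%:R]natr1; congr Gamma; ring.
have hj : h j = (fun t => Gamma (n%:R + j%:R + alpha - 1) / (2 ^+ j * Gamma (n%:R + 1)) *:
    jacobiP (nu + j%:R) (mu + j%:R) (n - j.+1).+1 t).
  by apply/funext => t; rewrite /h (ltnW jn) subnSK.
rewrite hj; have dJ := is_derive_jacobiP (nu + j%:R) (mu + j%:R) (n - j.+1) x.
apply: is_derive_eq; rewrite /h jn GE /GRing.scale/=.
rewrite -[j.+1%:R]natr1 !addrA exprS.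
have -> : (n - j.+1).+1%:R = n%:R - j%:R :> R by rewrite subnSK// natrB// ltnW.
have -> : n%:R - j%:R + nu + j%:R + mu + j%:R + 1 = n%:R + j%:R + alpha - 1 by lra.
have G0 : Gamma (n%:R + 1) != 0 :> R by apply: Gamma_neq0; lra.
have t0 : 2 ^+ j != 0 :> R by rewrite expf_neq0.
move: (Gamma _) (Gamma _) (jacobiP _ _ _ _) (2 ^+ j) G0 t0 => A B J q B0 t0.
by field; rewrite ?B0 ?t0.
Qed.

Theorem theorem2p2 (R : realType) (p alpha mu nu : R)
  (hp : 0 <= p <= 1) (halpha : 1 < alpha < 2)
  (hmu : alpha - 2 <= mu <= 0) (hnu : alpha - 2 <= nu <= 0)
  (hsum : mu + nu = alpha - 2)
  (hsin : p * sin (pi * mu) = (1 - p) * sin (pi * nu)) :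
  (forall (n : nat) (x : R), -1 < x < 1 ->
     twoSidedInt alpha p mu nu (2 - alpha) (polyfrac mu nu n) x
     = Gamma (n%:R + alpha - 1) / Gamma (n%:R + 1) * jacobiP nu mu n x)
  /\
  (forall (n k : nat), (1 <= k)%N ->
     (* D^{q} with q = k + alpha - 2 in (k-1,k):  d^k/dx^k  I^{k-q} *)
     is_kth_derivative_on (-1) 1 k
       (twoSidedInt alpha p mu nu (k%:R - (k%:R + alpha - 2)) (polyfrac mu nu n))
       (fun x => Gamma (n%:R + k%:R + alpha - 1) / (2 ^+ k * Gamma (n%:R + 1))
                 * (if (k <= n)%N
                    then jacobiP (nu + k%:R) (mu + k%:R) (n - k) x
                    else 0))).
Proof.
pose s := 2 - alpha.
have hs : 0 < s < 1 by rewrite /s; lra.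
have hmu' : - s <= mu <= 0 by rewrite /s; lra.
have hnu' : - s <= nu <= 0 by rewrite /s; lra.
have hsum' : mu + nu = - s by rewrite /s; lra.
have int n x : -1 < x < 1 ->
    twoSidedInt alpha p mu nu (2 - alpha) (polyfrac mu nu n) x
    = Gamma (n%:R + alpha - 1) / Gamma (n%:R + 1) * jacobiP nu mu n x.
  move=> xI.
  have := twoSidedInt_jacobi p s mu nu hp hs hmu' hnu' hsum' hsin n x xI.
  have -> : 2 - s = alpha by rewrite /s; ring.
  by have -> : n%:R + (1 - s) = n%:R + alpha - 1 by rewrite /s; ring.
split => // n k k1.
exists (fun i t => Gamma (n%:R + i%:R + alpha - 1) / (2 ^+ i * Gamma (n%:R + 1)) *
  (if (i <= n)%N then jacobiP (nu + i%:R) (mu + i%:R) (n - i) t else 0)).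
split; last split=> //.
- move=> x xI.
  (* The order of the inner integral does not depend on [k], so the first part gives the base of the
     tower. *)
  have -> : k%:R - (k%:R + alpha - 2) = 2 - alpha by ring.
  by rewrite int// subn0 !addr0 expr0 mul1r.
- move=> j _ x _; apply: is_derive_jacobi_tower => //.
  by case/andP: halpha.
Qed.
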